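(* Let $T>0$, $\beta\in(0,1)$ and $m>0$. There exist $s_0>0$, $\lambda>0$, $\varepsilon>0$, $h_0>0$ and a constant $M=M(s_0,\lambda,T,m,\varepsilon,\beta)>0$ such that for all $h\in(0,h_0)$ (of the form $h=1/(N+1)$, $N\in\mathbb N$), all $q_h\in L^\infty_{h,\le m}(0,1)$, all $s\in(s_0,\varepsilon/h)$ and all time-dependent discrete functions $w_h=(w_{j,h}(t))_{0\le j\le N+1}$, $t\in(-T,T)$, satisfying, with $L_h[q_h]w_h=\partial_{tt}w_h-\Delta_hw_h+q_hw_h$, $$L_h[q_h]w_h\in L^2(-T,T;L_h^2(0,1)),\qquad w_{0,h}(t)=w_{N+1,h}(t)=0\ \text{ on }(-T,T),\qquad w_h(\pm T)=\partial_tw_h(\pm T)=0,$$ one has $$s\int_{-T}^T\!\int_{(0,1)}e^{2s\varphi}|\partial_tw_h|^2dt+s\int_{-T}^T\!\int_{[0,1)}e^{2s\varphi}|\partial_h^+w_h|^2dt+s^3\int_{-T}^T\!\int_{(0,1)}e^{2s\varphi}|w_h|^2dt$$ $$\le M\int_{-T}^T\!\int_{(0,1)}e^{2s\varphi}|L_h[q_h]w_h|^2dt+Ms\int_{-T}^Te^{2s\varphi(t,1)}\big|(\partial_h^-w_h)_{N+1}\big|^2dt+Ms\int_{-T}^T\!\int_{[0,1)}e^{2s\varphi}|h\,\partial_h^+\partial_tw_h|^2dt .$$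
   Context: For $N\in\mathbb N$ put $h=1/(N+1)$, $x_j=jh$. For discrete functions: $(\Delta_hv)_j=(v_{j+1}-2v_j+v_{j-1})/h^2$, $(\partial_h^+v)_j=(\partial_h^-v)_{j+1}=(v_{j+1}-v_j)/h$; $\int_{(0,1)}f=h\sum_{j=1}^Nf_j$, $\int_{[0,1)}f=h\sum_{j=0}^Nf_j$; $\|f\|^2_{L_h^2(0,1)}=\int_{(0,1)}|f|^2$. $L^\infty_{h,\le m}(0,1)=\{q_h=(q_{j,h})_{1\le j\le N}:\sup_{1\le j\le N}|q_{j,h}|\le m\}$, and $(q_hw_h)_j=q_{j,h}w_{j,h}$. A continuous function of $x$ appearing in a discrete integral is evaluated at the points $x_j$. Weight functions: fix $x^0<0$ and $C_0>0$ such that $\psi(t,x)=|x-x^0|^2-\beta t^2+C_0$ satisfies $\psi\ge1$ on $[-T,T]\times[0,1]$; for the parameter $\lambda>0$, $\varphi(t,x)=e^{\lambda\psi(t,x)}$. The point $x^0$ and constant $C_0$ are fixed once and for all. *)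

(* Defs.v *)
From HB Require Import structures.
From mathcomp Require Import all_boot all_order all_algebra.
From mathcomp Require Import all_classical all_reals all_analysis.

Set Implicit Arguments.
Unset Strict Implicit.
Unset Printing Implicit Defensive.

Import Order.TTheory GRing.Theory Num.Theory.
Import numFieldNormedType.Exports.

Local Open Scope classical_set_scope.
Local Open Scope ring_scope.

(* A discrete function is a sequence v : nat -> R of which only the values
   v j with 0 <= j <= N + 1 are ever used.  A time-dependent discrete function
   is w : nat -> R -> R, with w j t the value at the point x_j and time t. *)

Definition mesh (R : realType) (N : nat) : R := (N.+1%:R)^-1.

Definition grid (R : realType) (N j : nat) : R := j%:R * mesh R N.

Section DiscreteCalculus.
Variables (R : realType) (N : nat).
Implicit Types v f : nat -> R.
Local Notation h := (mesh R N).

(* Meaningful for 1 <= j <= N. *)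
Definition discr_laplacian v (j : nat) : R :=
  (v j.+1 - 2 * v j + v j.-1) / h ^+ 2.

(* Meaningful for 0 <= j <= N. *)
Definition diff_plus v (j : nat) : R := (v j.+1 - v j) / h.

(* Meaningful for 1 <= j <= N + 1. *)
Definition diff_minus v (j : nat) : R := (v j - v j.-1) / h.

(* The discrete integrals over (0,1) and over [0,1). *)
Definition int_oo f : R := h * \sum_(1 <= j < N.+1) f j.

Definition int_co f : R := h * \sum_(0 <= j < N.+1) f j.

Definition discr_Linfty_le (m : R) (q : nat -> R) : Prop :=
  forall j, (1 <= j <= N)%N -> `|q j| <= m.

End DiscreteCalculus.

Definition psi (R : realType) (x0 beta C0 t x : R) : R :=
  `|x - x0| ^+ 2 - beta * t ^+ 2 + C0.

Definition phi (R : realType) (x0 beta C0 lambda t x : R) : R :=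
  expR (lambda * psi x0 beta C0 t x).

(* Time integrals over (-T,T) are Lebesgue integrals over [-T,T]; the end
   points are negligible.  The value is an extended real, so that no
   integrability of g is presupposed. *)
Definition int_time (R : realType) (T : R) (g : R -> R) : \bar R :=
  \int[lebesgue_measure]_(t in `[(- T)%R, T]) (g t)%:E.

(* u is absolutely continuous on [-T,T], i.e. u is the continuous
   representative of a function in W^{1,1}(-T,T), and its weak derivative is
   (the class of) g. *)
Definition time_derivative (R : realType) (T : R) (u g : R -> R) : Prop :=
  lebesgue_measure.-integrable `[- T, T] (EFin \o g) /\
  forall t, t \in `[- T, T] ->
    u t = u (- T) + Rintegral lebesgue_measure `[- T, t] g.

(* Membership in L^2(-T,T; L_h^2(0,1)). *)
Definition L2_time_L2h (R : realType) (N : nat) (T : R) (f : nat -> R -> R)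
    : Prop :=
  (forall j, (1 <= j <= N)%N -> measurable_fun `[- T, T] (f j)) /\
  (int_time T (fun t => int_oo N (fun j => `|f j t| ^+ 2)%R)%R < +oo)%E.

(* L_h[q] w, where wtt stands for the second time derivative of w. *)
Definition wave_op (R : realType) (N : nat) (q : nat -> R)
    (w wtt : nat -> R -> R) (j : nat) (t : R) : R :=
  wtt j t - discr_laplacian N (fun i => w i t) j + q j * w j t.

(* Main.v *)
Require Import Defs.
From HB Require Import structures.
From mathcomp Require Import all_boot all_order all_algebra.
From mathcomp Require Import all_classical all_reals all_analysis measurable_realfun.
From mathcomp Require Import ring lra.

Set Implicit Arguments.
Unset Strict Implicit.
Unset Printing Implicit Defensive.

Import Order.TTheory GRing.Theory Num.Theory.
Import numFieldNormedType.Exports.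

Local Open Scope classical_set_scope.
Local Open Scope ring_scope.

(** Put v = e^(s phi) w and p = s h phi_x(x_j).  At the node x_j the conjugated
    operator e^(s phi) L_h (e^(-s phi) v) is S v + A v + O(s) |v| with
      S v = v_tt - cosh p Delta_h v + (s^2 phi_t^2 - 2 (cosh p - 1) / h^2) v,
      A v = - 2 s phi_t v_t + (sinh p / h) (d_j + d_(j-1)),   d = diff_plus v,
    and 4 (S v)(A v) <= (S v + A v)^2.  Summation by parts turns the sum of
    (S v)(A v) into the time derivative of a flux that vanishes at -T and T,
    plus, edge by edge, a quadratic form in (v_t, d, s v) and boundary terms.
    As s h tends to 0 this form tends to its continuous analogue, which is
    positive definite once lambda (1 - beta) x0^2 >= 1, except that v_t at the
    two ends of an edge enters through the product v_(t,j) v_(t,j+1): this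
    costs |h diff_plus v_t|^2, the last term of the estimate.  Hence the
    estimate already holds at each fixed time up to the derivative of the flux,
    and the only analysis needed in time is the product rule for absolutely
    continuous functions. *)

(** * Products of absolutely continuous functions *)

(** In e^(s phi) Delta_h (e^(-s phi) v) the neighbours of v_j carry the factors e^(-s (phi_(j+1) -
    phi_j)) and e^(-s (phi_(j-1) - phi_j)). Replacing these increments of phi by h phi_x and - h
    phi_x makes the factors mutually inverse, whence cosh p and sinh p. The exponents change by O(s
    h^2), so after division by h^2 the error is O(s) |v|, which the term s^3 |v|^2 absorbs for large
    s. For the same reason S and A need not be the exact symmetric and antisymmetric parts:
    zero-order terms such as s phi_tt v go to the remainder. With these explicit coefficients the
    summation by parts is an exact identity between arbitrary sequences; asymptotics enter when the
    coefficients of the edge form are compared with their limits. What has to be secured is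
    uniformity: no constant may depend on N, s, t or j. All comparisons therefore take place on one
    space of cells (t, x, h, s), with errors measured by s h. The parameters act separately: lambda
    makes the limit form positive, small s h controls the discretisation errors, large s the
    remainder. *)

Lemma segment_unif_continuous (R : realType) (a b : R) (f : R -> R) :
  {within `[a, b], continuous f} ->
  forall e : R, 0 < e -> exists2 d, 0 < d &
    {in `[a, b] &, forall x y, `|x - y| < d -> `|f x - f y| < e}.
Proof.
move=> cf e e0.
have e20 : 0 < e / 2 by rewrite divr_gt0.
pose P (d x : R) := x \in `[a, b] -> forall y, y \in `[a, b] -> `|x - y| < d ->
  `|f x - f y| < e.
have : \forall d \near 0^'+, `[a, b] `<=` P d.
  have /compact_near_coveringP := @segment_compact R a b.
  apply => x xab.
  have /subspace_continuousP/(_ x xab)/cvgrPdist_lt/(_ _ e20) := cf.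
  rewrite near_withinE => -[/= r r0 rP].
  have r20 : 0 < r / 2 by rewrite divr_gt0.
  (* Half the radius: [x'] is within r / 2 of [x] and [y] within r / 2 of [x'], so both lie in the
     ball of radius r where [f] is e / 2 close to [f x]. *)
  exists (ball x (r / 2), [set d | d < r / 2]).
    by split; [exact: nbhsx_ballx|exact: nbhs_right_lt].
  move=> [x' d] /= [xx' dr] x'ab y yab x'y.
  rewrite /ball/= in xx'.
  have h1 : `|f x - f x'| < e / 2.
    by apply: rP => //=; rewrite /ball_/=; lra.
  have h2 : `|f x - f y| < e / 2.
    apply: rP => //=; rewrite /ball_/=.
    by have := ler_distD x' x y; lra.
  by have := ler_distD (f x) (f x') (f y); rewrite (distrC _ (f x)); lra.
move=> H; near (0 : R)^'+ => d.
exists d; first by near: d; exact: nbhs_right_gt.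
move=> x y xab yab xy.
have /(_ x) : `[a, b] `<=` P d by near: d.
by apply.
Unshelve. all: by end_near.
Qed.

Section RealIntegrable.
Context d (X : measurableType d) (R : realType) (mu : {measure set X -> \bar R}).
Variables (D : set X) (mD : measurable D).
Implicit Types f g : X -> R.

Lemma EFin_integrableD f g :
  mu.-integrable D (EFin \o f) -> mu.-integrable D (EFin \o g) ->
  mu.-integrable D (EFin \o (fun t => f t + g t)).
Proof. by move=> fi gi; have := integrableD mD fi gi. Qed.

Lemma EFin_integrableB f g :
  mu.-integrable D (EFin \o f) -> mu.-integrable D (EFin \o g) ->
  mu.-integrable D (EFin \o (fun t => f t - g t)).
Proof. by move=> fi gi; have := integrableB mD fi gi. Qed.

Lemma EFin_integrableZ (k : R) f :
  mu.-integrable D (EFin \o f) -> mu.-integrable D (EFin \o (fun t => k * f t)).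
Proof. by move=> fi; have := integrableZl mD k fi. Qed.

Lemma EFin_integrable_norm f :
  mu.-integrable D (EFin \o f) -> mu.-integrable D (EFin \o (fun t => `|f t|)).
Proof. by move=> fi; exact: integrable_norm. Qed.

End RealIntegrable.

Section TimeDerivative.
Variables (R : realType) (T : R).
Hypothesis T_gt0 : 0 < T.
Local Notation mu := (@lebesgue_measure R).
Local Notation I := `[- T, T]%classic.
Implicit Types u v g f : R -> R.

Let NTT : - T <= T. Proof. by move: T_gt0; lra. Qed.

Lemma time_derivative_continuous u g :
  time_derivative T u g -> {within I, continuous u}.
Proof.
move=> [ig uE].
have c := @parameterized_integral_continuous R (- T) T g NTT ig.
apply: (@subspace_eq_continuous _ _ _
  (fun t => u (- T) + parameterized_integral mu (- T) t g)).
  by move=> t; rewrite inE => tI; rewrite [RHS]uE.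
by move=> t; apply: cvgD; [exact: cvg_cst|exact: c].
Qed.

Lemma within_continuous_integrable u :
  {within I, continuous u} -> mu.-integrable I (EFin \o u).
Proof. by move=> cu; apply: continuous_compact_integrable => //; exact: segment_compact. Qed.

Lemma within_continuous_measurable u :
  {within I, continuous u} -> measurable_fun I u.
Proof. by move=> cu; apply: subspace_continuous_measurable_fun. Qed.

Lemma within_continuous_bounded u :
  {within I, continuous u} -> [bounded u x | x in I].
Proof.
move=> cu.
have /compact_bounded[M [_ mrt]] := continuous_compact cu (@segment_compact R _ _).
by exists M; split; rewrite ?num_real // => ? ? ? ?; apply: mrt => //; exists x.
Qed.

Lemma within_continuousM_integrable u g :
  {within I, continuous u} -> mu.-integrable I (EFin \o g) ->
  mu.-integrable I (EFin \o (fun t => u t * g t)).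
Proof.
move=> cu ig.
have -> : EFin \o (fun t => u t * g t) = ((EFin \o u) \* (EFin \o g))%E by [].
apply: integrableMr => //; last exact: within_continuous_bounded.
exact: within_continuous_measurable.
Qed.

Lemma integrable_subitv g s t : - T <= s -> t <= T ->
  mu.-integrable I (EFin \o g) -> mu.-integrable `[s, t] (EFin \o g).
Proof.
by move=> Ts tT; apply: integrableS => //; apply: subset_itv; rewrite bnd_simp.
Qed.

Lemma Rintegral_increment g s t : mu.-integrable I (EFin \o g) ->
  - T <= s -> s <= t -> t <= T ->
  Rintegral mu `[- T, t] g - Rintegral mu `[- T, s] g = Rintegral mu `[s, t] g.
Proof.
move=> ig Ts st tT.
have it : mu.-integrable `[- T, t] (EFin \o g) by exact: integrable_subitv.
rewrite Rintegral_itvB ?bnd_simp// Rintegral_itv_obnd_cbnd//.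
apply: integrableS it => //; apply: subset_itvr; rewrite bnd_simp; exact: Ts.
Qed.

Lemma time_derivative_increment u g s t : time_derivative T u g ->
  - T <= s -> s <= t -> t <= T ->
  u t - u s = Rintegral mu `[s, t] g.
Proof.
move=> [ig uE] Ts st tT.
rewrite (uE t) ?(uE s) ?in_itv/=; [|lra|lra].
by rewrite opprD addrACA subrr add0r Rintegral_increment.
Qed.

(* Adding up the increments over a fine partition bounds [F t - F (- T)] by
   [e * (K t - K (- T))], for every [e]. *)
Lemma chain_increment (F K : R -> R) :
  (forall e, 0 < e -> exists2 d, 0 < d & forall s t,
     - T <= s -> s <= t -> t <= T -> t - s < d ->
     `|F t - F s| <= e * (K t - K s)) ->
  forall t, - T <= t -> t <= T -> F t = F (- T).
Proof.
move=> FK t Tt tT.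
pose k := K t - K (- T).
have main : forall e, 0 < e -> `|F t - F (- T)| <= e * k.
  move=> e /FK[d d0 dFK].
  have [n nd] : exists n : nat, (t + T) / d < n%:R.
    exists (Num.trunc ((t + T) / d)).+1.
    by rewrite truncnS_gt.
  have n0 : 0 < n%:R :> R by apply: le_lt_trans nd; rewrite divr_ge0//; lra.
  pose p i := - T + i%:R * ((t + T) / n%:R).
  have pS i : p i.+1 - p i = (t + T) / n%:R by rewrite /p -natr1; ring.
  have tT0 : 0 <= (t + T) / n%:R by rewrite divr_ge0 ?ler0n//; lra.
  have pn : p n = t by rewrite /p mulrC divfK ?gt_eqF//; ring.
  have p_le i : (i <= n)%N -> p i <= T.
    move=> ni; apply: le_trans tT; rewrite -pn /p lerD2l ler_wpM2r ?ler_nat//.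
  have p_ge i : - T <= p i by rewrite /p lerDl mulr_ge0.
  have H i : (i <= n)%N -> `|F (p i) - F (- T)| <= e * (K (p i) - K (- T)).
    elim: i => [_|i IH ni]; first by rewrite /p mul0r addr0 !subrr normr0 mulr0.
    have := IH (ltnW ni).
    have : `|F (p i.+1) - F (p i)| <= e * (K (p i.+1) - K (p i)).
      apply: dFK => //; [by rewrite -subr_ge0 pS|exact: p_le|].
      by rewrite pS ltr_pdivrMr// -ltr_pdivrMl// mulrC.
    have := ler_distD (F (p i)) (F (p i.+1)) (F (- T)).
    lra.
  by have := H n (leqnn n); rewrite pn.
apply/eqP; rewrite -subr_eq0 -normr_le0.
have k0 : 0 <= k by have := main 1 ltr01; rewrite mul1r; apply: le_trans.
apply/ler_addgt0Pr => e e0; rewrite add0r.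
(* Division by [k + 1], because [k] may vanish. *)
apply: le_trans (main (e / (k + 1)) _) _; first by rewrite divr_gt0//; lra.
by rewrite -mulrA ger_pMr// mulrC ler_pdivrMr; lra.
Qed.

(** On a short interval [a, b], u b v b - u a v a = v b (u b - u a) + u a (v b - v a) is the
    integral of [v b * g + u a * f]. Uniform continuity of [u] and [v] bounds its difference from
    the integral of [g * v + u * f] by e times the integral of |g| + |f|, an additive quantity;
    [chain_increment] concludes without an exchange of integrals. *)
Lemma time_derivativeM u g v f :
  time_derivative T u g -> time_derivative T v f ->
  time_derivative T (fun t => u t * v t) (fun t => g t * v t + u t * f t).
Proof.
move=> ug vf.
have [ig _] := ug; have [jf _] := vf.
have cu := time_derivative_continuous ug.
have cv := time_derivative_continuous vf.
have igv : mu.-integrable I (EFin \o (fun t => g t * v t)).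
  by under [_ \o _]eq_fun do rewrite /= mulrC; exact: within_continuousM_integrable.
have iuf := within_continuousM_integrable cu jf.
have iG : mu.-integrable I (EFin \o (fun t => g t * v t + u t * f t)).
  exact: EFin_integrableD.
split => // t; rewrite in_itv/= => /andP[Tt tT].
pose G t := g t * v t + u t * f t.
pose F t := u t * v t - Rintegral mu `[- T, t] G.
pose K t := Rintegral mu `[- T, t] (fun t => `|g t| + `|f t|).
have iK : mu.-integrable I (EFin \o (fun t => `|g t| + `|f t|)).
  by apply: EFin_integrableD => //; exact: EFin_integrable_norm.
suff : F t = F (- T).
  rewrite /F set_itv1 Rintegral_set1 subr0 => <-; ring.
apply: (@chain_increment F K) => // e e0.
have [d1 d10 ud] := segment_unif_continuous cu e0.
have [d2 d20 vd] := segment_unif_continuous cv e0.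
exists (Num.min d1 d2); first by rewrite lt_min d10.
move=> a b Ta ab bT; rewrite lt_min => /andP[bd1 bd2].
have Tb := le_trans Ta ab.
have aT := le_trans ab bT.
have i' h : mu.-integrable I (EFin \o h) -> mu.-integrable `[a, b] (EFin \o h).
  exact: integrable_subitv.
have i1 : mu.-integrable I (EFin \o (fun x => v b * g x + u a * f x)).
  by apply: EFin_integrableD => //; exact: EFin_integrableZ.
have i2 : mu.-integrable I (EFin \o
    (fun x => v b * g x + u a * f x - (g x * v x + u x * f x))).
  exact: EFin_integrableB.
have FE : F b - F a = Rintegral mu `[a, b]
    (fun x => (v b * g x + u a * f x) - (g x * v x + u x * f x)).
  rewrite RintegralB//; [|exact: i'..].
  rewrite RintegralD//; [|exact/i'/EFin_integrableZ..].
  rewrite !RintegralZl//; [|exact: i'..].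
  rewrite -(time_derivative_increment ug)// -(time_derivative_increment vf)//.
  by rewrite -(Rintegral_increment iG)// /F; ring.
rewrite FE /K (Rintegral_increment iK)// -RintegralZl//; last exact: i'.
apply: le_trans (le_normr_Rintegral _ _) _ => //; first exact: i'.
apply: le_Rintegral => //.
- exact/i'/EFin_integrable_norm.
- exact/i'/EFin_integrableZ.
move=> x; rewrite /= in_itv/= => /andP[ax xb].
have -> : v b * g x + u a * f x - (g x * v x + u x * f x) =
  (v b - v x) * g x + (u a - u x) * f x by ring.
apply: le_trans (ler_normD _ _) _; rewrite !normrM mulrDr.
apply: lerD; apply: ler_wpM2r => //; apply: ltW.
  apply: vd; rewrite ?in_itv/= ?Tb ?bT ?(le_trans Ta ax) ?(le_trans xb bT)//.
  by rewrite ger0_norm ?subr_ge0//; apply: le_lt_trans bd2; rewrite lerB.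
apply: ud; rewrite ?in_itv/= ?Ta ?aT ?(le_trans Ta ax) ?(le_trans xb bT)//.
by rewrite distrC ger0_norm ?subr_ge0//; apply: le_lt_trans bd1; rewrite lerB.
Qed.
End TimeDerivative.

(** * Rules for weak derivatives in time *)

Section TimeDerivativeRules.
Variables (R : realType) (T : R).
Hypothesis T_gt0 : 0 < T.
Local Notation mu := (@lebesgue_measure R).
Local Notation I := `[- T, T]%classic.
Implicit Types u v g f : R -> R.

Lemma eq_time_derivative u v g f : u =1 v -> g =1 f ->
  time_derivative T u g -> time_derivative T v f.
Proof. by move=> /funext <- /funext <-. Qed.

Lemma time_derivativeD u g v f :
  time_derivative T u g -> time_derivative T v f ->
  time_derivative T (fun t => u t + v t) (fun t => g t + f t).
Proof.
move=> [ig uE] [jf vE]; split; first exact: EFin_integrableD.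
move=> t tI; have := tI; rewrite in_itv/= => /andP[Tt tT].
have i' h : mu.-integrable I (EFin \o h) -> mu.-integrable `[- T, t] (EFin \o h).
  exact: integrable_subitv.
by rewrite (uE t)// (vE t)// RintegralD//; [ring|exact: i'..].
Qed.

Lemma is_derive_time_derivative u g :
  (forall t : R, is_derive t 1 u (g t)) -> continuous g -> time_derivative T u g.
Proof.
move=> du cg.
have cw A : {within A, continuous g} by exact: continuous_subspaceT.
split; first exact: within_continuous_integrable.
move=> t; rewrite in_itv/= le_eqVlt => /andP[/orP[/eqP <- _|Tt tT]].
  by rewrite set_itv1 Rintegral_set1 addr0.
have cu x : {for x, continuous u}.
  by apply: differentiable_continuous; apply/derivable1_diffP; have [] := du x.
rewrite /Rintegral (@continuous_FTC2 _ g u)//=; first by ring.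
  split=> [x _||]; first by have [] := du x.
    exact/cvg_at_right_filter/cu.
  exact/cvg_at_left_filter/cu.
by move=> x _; rewrite derive1E; have [] := du x.
Qed.

Lemma time_derivative_cst c : time_derivative T (fun=> c) (fun=> 0).
Proof.
by apply: is_derive_time_derivative => t; exact: cst_continuous.
Qed.

Lemma time_derivativeZ c u g : time_derivative T u g ->
  time_derivative T (fun t => c * u t) (fun t => c * g t).
Proof.
move=> ug; have := time_derivativeM T_gt0 (time_derivative_cst c) ug.
by apply: eq_time_derivative => t //; rewrite mul0r add0r.
Qed.

Lemma time_derivativeB u g v f :
  time_derivative T u g -> time_derivative T v f ->
  time_derivative T (fun t => u t - v t) (fun t => g t - f t).
Proof.
move=> ug vf; have := time_derivativeD ug (time_derivativeZ (- 1) vf).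
by apply: eq_time_derivative => t; rewrite mulN1r.
Qed.

Lemma time_derivative_sum (J : eqType) (r : seq J) (u g : J -> R -> R) :
  (forall j, j \in r -> time_derivative T (u j) (g j)) ->
  time_derivative T (fun t => \sum_(j <- r) u j t) (fun t => \sum_(j <- r) g j t).
Proof.
elim: r => [_|j r IH ug].
  by apply: eq_time_derivative (time_derivative_cst 0) => t; rewrite big_nil.
have jr : time_derivative T (u j) (g j) by apply: ug; rewrite mem_head.
apply: eq_time_derivative (time_derivativeD jr (IH _)) => [t|t|i ir];
  rewrite ?big_cons//.
by apply: ug; rewrite in_cons ir orbT.
Qed.

(** Transfers the Dirichlet condition from w to its velocity. The weak derivative is determined only
    almost everywhere; continuity of [g] makes the conclusion pointwise, through the fundamental
    theorem of calculus. *)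
Lemma time_derivative_eq0 u g :
  time_derivative T u g -> {within I, continuous g} ->
  {in I, forall t, u t = 0} -> forall t, t \in `]- T, T[ -> g t = 0.
Proof.
move=> [ig uE] cg u0 t tI; have := tI; rewrite in_itv/= => /andP[Tt tT].
have cgt : {for t, continuous g}.
  by apply: within_continuous_continuous cg tI; lra.
have [_ <-] := continuous_FTC1_closed tT ig Tt cgt.
rewrite derive1E (@near_eq_derive _ _ _ _ (cst 0)) ?derive_cst//.
have := near_in_itvoo tI; apply: filterS => x; rewrite in_itv/= => /andP[Tx xT].
have xI : x \in `[- T, T] by rewrite in_itv/= !ltW.
have := uE x xI; rewrite !u0 ?inE//= ?in_itv/=; [|lra..].
by rewrite add0r => <-.
Qed.

End TimeDerivativeRules.

(** * Bounds that are uniform in the mesh *)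

Section Hyperbolic.
Variable R : realType.
Implicit Types y z : R.

Definition sinhR y : R := (expR y - expR (- y)) / 2.
Definition coshR y : R := (expR y + expR (- y)) / 2.

(** The convexity bound 1 + y <= e^y, taken at y and at -y, suffices: the second gives e^y - 1 <= y
    e^y, hence 0 <= e^y - 1 - y <= y (e^y - 1). *)
Lemma expR_sub1_bound y : `|expR y - 1 - y| <= y ^+ 2 * expR `|y|.
Proof.
have ge := expR_ge1Dx y.
have le : expR y - 1 - y <= y * (expR y - 1).
  have := expR_ge1Dx (- y); have := expRxMexpNx_1 y.
  have := expR_gt0 y; nra.
rewrite ger0_norm; last lra.
apply: le_trans le _; have [y0|y0] := leP 0 y.
  by rewrite ger0_norm// expr2 -mulrA ler_wpM2l//; have := expRxMexpNx_1 y;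
    have := expR_ge1Dx (- y); have := expR_gt0 y; nra.
have e1 : 1 <= expR `|y| by rewrite -expR0 ler_expR.
rewrite expr2; have : expR y <= 1 by rewrite -expR0 ler_expR ltW.
have : 0 <= y ^+ 2 by exact: sqr_ge0.
rewrite expr2; nra.
Qed.

Lemma sinhR_sub_bound y : `|sinhR y - y| <= y ^+ 2 * expR `|y|.
Proof.
have := expR_sub1_bound y; have := expR_sub1_bound (- y).
rewrite normrN sqrrN /sinhR => h1 h2.
have -> : (expR y - expR (- y)) / 2 - y =
  (expR y - 1 - y - (expR (- y) - 1 - - y)) / 2 by field.
rewrite normrM [`|2^-1|]ger0_norm ?invr_ge0// ler_pdivrMr//.
by apply: le_trans (ler_normB _ _) _; lra.
Qed.

Lemma coshR_sub1_bound y : `|coshR y - 1| <= y ^+ 2 * expR `|y|.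
Proof.
have := expR_sub1_bound y; have := expR_sub1_bound (- y).
rewrite normrN sqrrN /coshR => h1 h2.
have -> : (expR y + expR (- y)) / 2 - 1 =
  (expR y - 1 - y + (expR (- y) - 1 - - y)) / 2 by field.
rewrite normrM [`|2^-1|]ger0_norm ?invr_ge0// ler_pdivrMr//.
by apply: le_trans (ler_normD _ _) _; lra.
Qed.

(** The sum-to-product formulas, here and for [coshR], factor the increment of sinh p or cosh p
    along an edge exactly, and the half-difference factor is the small one. Slopes of the
    coefficients can then be estimated without a mean value theorem. *)
Lemma sinhRB y z : sinhR y - sinhR z = 2 * coshR ((y + z) / 2) * sinhR ((y - z) / 2).
Proof.
rewrite /sinhR /coshR; set a := (y + z) / 2; set b := (y - z) / 2.
have -> : y = a + b by rewrite /a /b; field.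
have -> : z = a - b by rewrite /a /b; field.
by rewrite !opprD opprK !expRD; field.
Qed.

Lemma coshRB y z : coshR y - coshR z = 2 * sinhR ((y + z) / 2) * sinhR ((y - z) / 2).
Proof.
rewrite /sinhR /coshR; set a := (y + z) / 2; set b := (y - z) / 2.
have -> : y = a + b by rewrite /a /b; field.
have -> : z = a - b by rewrite /a /b; field.
by rewrite !opprD opprK !expRD; field.
Qed.

Lemma sqrM_le_norm (c y e : R) : 0 <= e ->
  (c * y) ^+ 2 * e <= `|c * (y ^+ 2 * e)| * `|c|.
Proof.
move=> e0; have cc : `|c| * `|c| = c ^+ 2 by rewrite -normrM -expr2 ger0_norm ?sqr_ge0.
rewrite exprMn -cc normrM (ger0_norm (mulr_ge0 (sqr_ge0 _) e0)).
by rewrite le_eqVlt; apply/orP; left; apply/eqP; ring.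
Qed.

End Hyperbolic.

(** * Calculus of uniform O(1) and O(eta) bounds *)

Section BoundCalculus.
Variables (R : realType) (W : Type) (D : W -> Prop) (eta : W -> R).
Hypothesis eta_le1 : forall w, D w -> `|eta w| <= 1.
Implicit Types f g : W -> R.

(** O(1), O(eta) and equality modulo O(eta), uniformly over [D]. With cells for [W] and s h for
    [eta], the constants depend neither on the mesh nor on s. *)
Definition bounded_on f := exists C : R, forall w, D w -> `|f w| <= C.
Definition small_on f := exists C : R, forall w, D w -> `|f w| <= C * `|eta w|.
Definition approx_on f g := small_on (fun w => f w - g w).

Lemma bounded_on_cst c : bounded_on (fun=> c).
Proof. by exists `|c|. Qed.

Lemma bounded_onD f g : bounded_on f -> bounded_on g -> bounded_on (fun w => f w + g w).
Proof.
move=> [C HC] [C' HC']; exists (C + C') => w Dw.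
by apply: le_trans (ler_normD _ _) _; apply: lerD; [exact: HC|exact: HC'].
Qed.

Lemma bounded_onN f : bounded_on f -> bounded_on (fun w => - f w).
Proof. by move=> [C HC]; exists C => w Dw; rewrite normrN; exact: HC. Qed.

Lemma bounded_onM f g : bounded_on f -> bounded_on g -> bounded_on (fun w => f w * g w).
Proof.
move=> [C HC] [C' HC']; exists (C * C') => w Dw.
by rewrite normrM ler_pM//; [exact: HC|exact: HC'].
Qed.

Lemma bounded_onX f n : bounded_on f -> bounded_on (fun w => f w ^+ n).
Proof.
move=> [C HC]; exists (C ^+ n) => w Dw.
by rewrite normrX lerXn2r ?nnegrE ?(le_trans _ (HC w Dw)) ?HC.
Qed.

Lemma bounded_on_expR f : bounded_on f -> bounded_on (fun w => expR (f w)).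
Proof.
move=> [C HC]; exists (expR C) => w Dw; rewrite ger0_norm ?expR_ge0// ler_expR.
exact: le_trans (ler_norm _) (HC w Dw).
Qed.

Lemma bounded_on_norm f : bounded_on f -> bounded_on (fun w => `|f w|).
Proof. by move=> [C HC]; exists C => w Dw; rewrite normr_id; exact: HC. Qed.

Lemma small_bounded_on f : small_on f -> bounded_on f.
Proof.
move=> [C HC]; exists `|C| => w Dw; apply: le_trans (HC w Dw) _.
apply: le_trans (ler_norm _) _; rewrite normrM normr_id ler_piMr//.
exact: eta_le1.
Qed.

Lemma small_on_eta : small_on eta.
Proof. by exists 1 => w _; rewrite mul1r. Qed.

Lemma small_onD f g : small_on f -> small_on g -> small_on (fun w => f w + g w).
Proof.
move=> [C HC] [C' HC']; exists (C + C') => w Dw; rewrite mulrDl.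
by apply: le_trans (ler_normD _ _) _; apply: lerD; [exact: HC|exact: HC'].
Qed.

Lemma small_onM f g : small_on f -> bounded_on g -> small_on (fun w => f w * g w).
Proof.
move=> [C HC] [C' HC']; exists (C * C') => w Dw.
by rewrite normrM mulrAC ler_pM//; [exact: HC|exact: HC'].
Qed.

Lemma small_onMl f g : bounded_on f -> small_on g -> small_on (fun w => f w * g w).
Proof.
by move=> bf sg; under [X in small_on X]eq_fun do rewrite mulrC; exact: small_onM.
Qed.

Lemma eq_small_on f g : (forall w, D w -> f w = g w) -> small_on f -> small_on g.
Proof. by move=> fg [C HC]; exists C => w Dw; rewrite -fg//; exact: HC. Qed.

Lemma eq_bounded_on f g : (forall w, D w -> f w = g w) -> bounded_on f -> bounded_on g.
Proof. by move=> fg [C HC]; exists C => w Dw; rewrite -fg//; exact: HC. Qed.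

Lemma eq_approx_onl f f' g : (forall w, D w -> f w = f' w) ->
  approx_on f g -> approx_on f' g.
Proof. by move=> ff'; apply: eq_small_on => w Dw; rewrite ff'. Qed.

Lemma approx_onxx f : approx_on f f.
Proof. by exists 0 => w _; rewrite subrr normr0 mul0r. Qed.

Lemma approx_onD f g f' g' : approx_on f g -> approx_on f' g' ->
  approx_on (fun w => f w + f' w) (fun w => g w + g' w).
Proof.
by move=> h h'; apply: eq_small_on (small_onD h h') => w _; ring.
Qed.

Lemma approx_onN f g : approx_on f g -> approx_on (fun w => - f w) (fun w => - g w).
Proof.
by move=> h; apply: eq_small_on (small_onMl (bounded_on_cst (-1)) h) => w _; ring.
Qed.

Lemma approx_bounded_on f g : bounded_on g -> approx_on f g -> bounded_on f.
Proof.
move=> bg /small_bounded_on h; apply: eq_bounded_on (bounded_onD h bg) => w _.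
by ring.
Qed.

Lemma approx_onM f g f' g' : bounded_on g -> bounded_on g' ->
  approx_on f g -> approx_on f' g' ->
  approx_on (fun w => f w * f' w) (fun w => g w * g' w).
Proof.
move=> bg bg' h h'; have bf' := approx_bounded_on bg' h'.
apply: eq_small_on (small_onD (small_onM h bf') (small_onMl bg h')) => w _.
by ring.
Qed.

Lemma approx_on_trans f g k : approx_on f g -> approx_on g k -> approx_on f k.
Proof. by move=> h h'; apply: eq_small_on (small_onD h h') => w _; ring. Qed.

Lemma approx_expR_sub1_div c y : bounded_on y -> small_on c ->
  (forall w, D w -> c w != 0) ->
  approx_on (fun w => (expR (c w * y w) - 1) / c w) y.
Proof.
move=> by_ sc c0.
have be := bounded_onM (bounded_onX 2 by_) (bounded_on_expR (bounded_on_norm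
  (bounded_onM (small_bounded_on sc) by_))).
have [C HC] := small_onM sc be; exists C => w Dw; apply: le_trans (HC w Dw).
have -> : (expR (c w * y w) - 1) / c w - y w =
  (expR (c w * y w) - 1 - c w * y w) / c w by field; exact: c0.
rewrite normrM normfV ler_pdivrMr ?normr_gt0 ?c0//.
apply: le_trans (expR_sub1_bound _) _.
exact/sqrM_le_norm/expR_ge0.
Qed.

Lemma approx_sinhR_div c y : bounded_on y -> small_on c ->
  (forall w, D w -> c w != 0) ->
  approx_on (fun w => sinhR (c w * y w) / c w) y.
Proof.
move=> by_ sc c0.
have be := bounded_onM (bounded_onX 2 by_) (bounded_on_expR (bounded_on_norm
  (bounded_onM (small_bounded_on sc) by_))).
have [C HC] := small_onM sc be; exists C => w Dw; apply: le_trans (HC w Dw).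
have -> : sinhR (c w * y w) / c w - y w =
  (sinhR (c w * y w) - c w * y w) / c w by field; exact: c0.
rewrite normrM normfV ler_pdivrMr ?normr_gt0 ?c0//.
apply: le_trans (sinhR_sub_bound _) _.
exact/sqrM_le_norm/expR_ge0.
Qed.

Lemma approx_coshR c y : bounded_on y -> small_on c ->
  approx_on (fun w => coshR (c w * y w)) (fun=> 1).
Proof.
move=> by_ sc.
have be := bounded_onM (small_bounded_on sc) (bounded_onM (bounded_onX 2 by_)
  (bounded_on_expR (bounded_on_norm (bounded_onM (small_bounded_on sc) by_)))).
have [C HC] := small_onM sc be; exists C => w Dw; apply: le_trans (HC w Dw).
apply: le_trans (coshR_sub1_bound _) _.
by apply: le_trans (ler_norm _); rewrite le_eqVlt; apply/orP; left; apply/eqP; ring.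
Qed.

End BoundCalculus.

(** * Grid sums and smooth functions of time *)

(** Summation by parts as a regrouping: an interior node j gives [L j] to the edge on its right and
    [Rr j.-1] to the edge on its left. The nodes 0 and N + 1 are not summed, so their shares of the
    first and last edges are subtracted. *)
Lemma big_node_edge (R : comRingType) (N : nat) (L Rr : nat -> R) :
  \sum_(1 <= j < N.+1) (L j + Rr j.-1) =
  \sum_(0 <= j < N.+1) (L j + Rr j) - L 0%N - Rr N.
Proof.
elim: N => [|N IH]; first by rewrite big_geq// big_nat1; ring.
by rewrite big_nat_recr//= IH [in RHS]big_nat_recr//=; ring.
Qed.

Section Grid.
Variables (R : realType) (N : nat).
Local Notation h := (mesh R N).

Lemma mesh_gt0 : 0 < h. Proof. by rewrite invr_gt0 ltr0n. Qed.

Lemma gridS j : grid R N j.+1 = grid R N j + h.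
Proof. by rewrite /grid -natr1 mulrDl mul1r. Qed.

Lemma grid0 : grid R N 0 = 0. Proof. by rewrite /grid mul0r. Qed.

Lemma grid_last : grid R N N.+1 = 1.
Proof. by rewrite /grid mulfV ?pnatr_eq0. Qed.

Lemma grid_itv j : (j <= N.+1)%N -> 0 <= grid R N j <= 1.
Proof.
move=> jN; have h0 := ltW mesh_gt0; apply/andP; split; first exact: mulr_ge0.
by rewrite -grid_last; apply: ler_wpM2r; rewrite ?ler_nat.
Qed.

End Grid.

Lemma sqr_lincomb3_le (R : realDomainType) (A a b c x y z : R) :
  `|a| <= A -> `|b| <= A -> `|c| <= A ->
  (a * x + b * y + c * z) ^+ 2 <= 3 * A ^+ 2 * (x ^+ 2 + y ^+ 2 + z ^+ 2).
Proof.
have sq (e : R) : `|e| <= A -> e ^+ 2 <= A ^+ 2.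
  move=> eA; rewrite -[e ^+ 2]ger0_norm ?sqr_ge0// normrX lerXn2r ?nnegrE//.
  exact: le_trans eA.
move=> /sq aA /sq bA /sq cA.
have hx := ler_wpM2r (sqr_ge0 x) aA; have hy := ler_wpM2r (sqr_ge0 y) bA.
have hz := ler_wpM2r (sqr_ge0 z) cA.
have h1 := sqr_ge0 (a * x - b * y); have h2 := sqr_ge0 (b * y - c * z).
have h3 := sqr_ge0 (a * x - c * z).
apply: (@le_trans _ _ (3 * (a ^+ 2 * x ^+ 2 + b ^+ 2 * y ^+ 2 + c ^+ 2 * z ^+ 2))).
  rewrite -subr_ge0.
  have -> : 3 * (a ^+ 2 * x ^+ 2 + b ^+ 2 * y ^+ 2 + c ^+ 2 * z ^+ 2) -
    (a * x + b * y + c * z) ^+ 2 =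
    (a * x - b * y) ^+ 2 + (b * y - c * z) ^+ 2 + (a * x - c * z) ^+ 2 by ring.
  by rewrite !addr_ge0.
by rewrite -mulrA ler_wpM2l// !mulrDr !lerD.
Qed.

Lemma sum_node_le_edge (R : numDomainType) (N : nat) (F G : nat -> R) :
  (forall j, (j <= N)%N -> F j <= G j) -> 0 <= G 0%N ->
  \sum_(1 <= j < N.+1) F j <= \sum_(0 <= j < N.+1) G j.
Proof.
move=> FG G0; rewrite [leRHS]big_ltn// -[leLHS]add0r lerD//.
by apply: ler_sum_nat => j /andP[_ jN]; exact: FG.
Qed.

Lemma sum_node_pred_le_edge (R : numDomainType) (N : nat) (F G : nat -> R) :
  (forall j, (j <= N)%N -> F j <= G j) -> 0 <= G N ->
  \sum_(1 <= j < N.+1) F j.-1 <= \sum_(0 <= j < N.+1) G j.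
Proof.
move=> FG GN; rewrite big_add1/= [leRHS]big_nat_recr//= -[leLHS]addr0 lerD//.
by apply: ler_sum_nat => j /andP[_ jN]; apply: FG; exact: ltnW.
Qed.

(** For a = S v, b = A v and r the residual, a + b + r is the weighted L_h w, so the residual enters
    only through its own square. *)
Lemma mul_le_sqr_halves (R : realFieldType) (a b r : R) :
  a * b <= (a + b + r) ^+ 2 / 2 + r ^+ 2 / 2.
Proof.
rewrite -subr_ge0.
have -> : (a + b + r) ^+ 2 / 2 + r ^+ 2 / 2 - a * b =
  ((a - b) ^+ 2 + (a + b + 2 * r) ^+ 2) / 4 by field.
by rewrite divr_ge0// addr_ge0 ?sqr_ge0.
Qed.

(** * Continuously differentiable coefficients *)

Section C1Functions.
Variable R : realType.
Implicit Types f g : R -> R.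

Definition C1_derivative f f' := (forall t : R, is_derive t 1 f (f' t)) /\ continuous f'.

Lemma C1_continuous f f' : C1_derivative f f' -> continuous f.
Proof.
move=> [df _] t; apply: differentiable_continuous.
by apply/derivable1_diffP; have [] := df t.
Qed.

Lemma C1_time_derivative T f f' : 0 < T -> C1_derivative f f' -> time_derivative T f f'.
Proof. by move=> T0 [df cf]; exact: is_derive_time_derivative. Qed.

Lemma C1_cst (c : R) : C1_derivative (fun=> c) (fun=> 0).
Proof. by split => [t|]; [exact: is_derive_cst|exact: cst_continuous]. Qed.

Lemma C1_id : C1_derivative id (fun=> 1).
Proof. by split => [t|]; [exact: is_derive_id|exact: cst_continuous]. Qed.

Lemma C1_D f f' g g' : C1_derivative f f' -> C1_derivative g g' ->
  C1_derivative (fun t => f t + g t) (fun t => f' t + g' t).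
Proof.
move=> [df cf] [dg cg]; split => [t|t].
  exact: (is_deriveD (df t) (dg t)).
exact: (cvgD (cf t) (cg t)).
Qed.

Lemma C1_M f f' g g' : C1_derivative f f' -> C1_derivative g g' ->
  C1_derivative (fun t => f t * g t) (fun t => f' t * g t + f t * g' t).
Proof.
move=> C1f C1g; have cf := C1_continuous C1f; have cg := C1_continuous C1g.
have [df cf'] := C1f; have [dg cg'] := C1g; split => [t|t].
  apply: is_derive_eq (is_deriveM (df t) (dg t)) _.
  by rewrite addrC; congr (_ + _); exact: mulrC.
exact: (cvgD (cvgM (cf' t) (cg t)) (cvgM (cf t) (cg' t))).
Qed.

Lemma C1_expR f f' : C1_derivative f f' ->
  C1_derivative (fun t => expR (f t)) (fun t => f' t * expR (f t)).
Proof.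
move=> C1f; have cf := C1_continuous C1f; have [df cf'] := C1f; split => [t|t].
  apply: is_derive_eq (is_derive1_comp (is_derive_expR (f t)) (df t)) _.
  exact: mulrC.
apply: cvgM; first exact: cf'.
apply: continuous_cvg; [exact: continuous_expR|exact: cf].
Qed.

Lemma eq_C1 f f' g g' : f =1 g -> f' =1 g' -> C1_derivative f f' -> C1_derivative g g'.
Proof. by move=> /funext <- /funext <-. Qed.

End C1Functions.

Ltac C1_solve := repeat first [exact: C1_cst | eassumption | apply: C1_expR | apply: C1_D | apply: C1_M ].

(** * The conjugated operator *)

Section CarlemanEstimate.
Variables (R : realType) (T x0 beta C0 lam : R).

Local Notation ph := (phi x0 beta C0 lam).
(** [xfac] and [tfac] are lambda psi_x and lambda psi_t. Every derivative of phi is phi times a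
    polynomial in them, so the positivity statements become polynomial inequalities. *)
Definition xfac (x : R) : R := 2 * lam * (x - x0).
Definition tfac (t : R) : R := - (2 * lam * beta * t).
Definition phi_x t x := xfac x * ph t x.
Definition phi_t t x := tfac t * ph t x.
Definition phi_tt t x := (tfac t ^+ 2 - 2 * lam * beta) * ph t x.
Definition phi_xx t x := (xfac x ^+ 2 + 2 * lam) * ph t x.
Definition phi_tx t x := xfac x * tfac t * ph t x.

(* With [e = s h]: the coefficients of the symmetric and antisymmetric parts,
   [gcoef] and [kcoef] being divided by [s] and [s ^+ 2].  As [e] tends to 0,
   [acoef], [gcoef], [kcoef] tend to [1], [phi_x], [phi_x ^+ 2]. *)
Definition acoef e t x := coshR (e * phi_x t x).
Definition gcoef e t x := sinhR (e * phi_x t x) / e.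
Definition kcoef e t x := 2 * (coshR (e * phi_x t x) - 1) / e ^+ 2.
Definition fcoef e t x := acoef e t x * phi_t t x.
Definition mcoef e t x := phi_t t x ^+ 2 - kcoef e t x.

Definition acoef_t e t x := sinhR (e * phi_x t x) * (e * phi_tx t x).
Definition gcoef_t e t x := coshR (e * phi_x t x) * phi_tx t x.
Definition kcoef_t e t x := 2 * gcoef e t x * phi_tx t x.
Definition fcoef_t e t x := acoef_t e t x * phi_t t x + acoef e t x * phi_tt t x.
Definition mcoef_t e t x := 2 * phi_t t x * phi_tt t x - kcoef_t e t x.
Definition zcoef_t e t x := mcoef_t e t x * phi_t t x + mcoef e t x * phi_tt t x.

(* The t-derivative of [(phi_t ^+ 2 - phi_x ^+ 2) * phi_t] and the x-derivative
   of [(phi_t ^+ 2 - phi_x ^+ 2) * phi_x]. *)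
Definition zlead_t t x :=
  (2 * phi_t t x * phi_tt t x - 2 * phi_x t x * phi_tx t x) * phi_t t x +
  (phi_t t x ^+ 2 - phi_x t x ^+ 2) * phi_tt t x.
Definition zlead_x t x :=
  (2 * phi_t t x * phi_tx t x - 2 * phi_x t x * phi_xx t x) * phi_x t x +
  (phi_t t x ^+ 2 - phi_x t x ^+ 2) * phi_xx t x.

(* [ch] may be negative: the cell [x - h, x] is the cell at [x] with step [- h]. *)
Record cell := Cell { ct : R; cx : R; ch : R; cs : R }.
Definition ceta w := cs w * ch w.
Definition cy w := cx w + ch w.
Definition cell_ok w :=
  [/\ `|ct w| <= T, 0 <= cx w <= 1, 0 <= cy w <= 1, ch w != 0 &
      1 <= cs w /\ `|ceta w| <= 1].

Local Notation bnd := (bounded_on cell_ok).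
Local Notation sml := (small_on cell_ok ceta).
Local Notation apx := (approx_on cell_ok ceta).

Let ceta_le1 w : cell_ok w -> `|ceta w| <= 1. Proof. by case=> _ _ _ _ []. Qed.
Let ceta_neq0 w : cell_ok w -> ceta w != 0.
Proof. by case=> _ _ _ h0 [s1 _]; rewrite /ceta mulf_neq0//; lra. Qed.
Let ch_neq0 w : cell_ok w -> ch w != 0. Proof. by case. Qed.

(** Since s >= 1, an error of order h is also of order s h; a single scale of smallness is
    enough. *)
Lemma small_ch : sml ch.
Proof.
exists 1 => w [_ _ _ _ [s1 _]]; rewrite mul1r /ceta normrM ler_peMl//.
by rewrite ger0_norm; lra.
Qed.

Lemma bounded_cx : bnd cx.
Proof. by exists 1 => w [_ /andP[? ?] _ _ _]; rewrite ger0_norm. Qed.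

Lemma bounded_ct : bnd ct.
Proof. by exists T => w []. Qed.

Ltac bounded_tac := repeat first [assumption | exact: bounded_on_cst | exact: bounded_cx
  | exact: bounded_ct | exact: (small_bounded_on ceta_le1 small_ch)
  | exact: (small_bounded_on ceta_le1 (small_on_eta _ _))
  | apply: bounded_onD | apply: bounded_onN | apply: bounded_onM
  | apply: bounded_onX ].

(** * Limits of the coefficients and of their slopes as s h tends to 0 *)

Section Approximations.

Lemma bounded_xfac : bnd (fun w => xfac (cx w)).
Proof. by rewrite /xfac; bounded_tac. Qed.
Lemma bounded_tfac : bnd (fun w => tfac (ct w)).
Proof. by rewrite /tfac; bounded_tac. Qed.

Lemma bounded_phi : bnd (fun w => ph (ct w) (cx w)).
Proof.
apply: bounded_on_expR; rewrite /psi.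
under [X in bnd X]eq_fun do rewrite (real_normK (num_real _)).
by bounded_tac.
Qed.

(** psi is quadratic in x, so its increment over a cell is an exact polynomial, and every expansion
    of phi reduces to that of the exponential. *)
Lemma phi_shift w : ph (ct w) (cy w) =
  ph (ct w) (cx w) * expR (ch w * (xfac (cx w) + lam * ch w)).
Proof.
rewrite /phi -expRD; congr expR.
by rewrite /psi !(real_normK (num_real _)) /cy /xfac; ring.
Qed.

Lemma phi_diff_quotient : apx (fun w => (ph (ct w) (cy w) - ph (ct w) (cx w)) / ch w)
  (fun w => phi_x (ct w) (cx w)).
Proof.
have h : apx (fun w => (expR (ch w * (xfac (cx w) + lam * ch w)) - 1) / ch w)
             (fun w => xfac (cx w)).
  apply: (approx_on_trans (g := fun w => xfac (cx w) + lam * ch w)).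
    apply: approx_expR_sub1_div => //; [|exact: small_ch].
    by have bx := bounded_xfac; bounded_tac.
  apply: eq_small_on (small_onMl (bounded_on_cst _ lam) small_ch) => w _.
  by rewrite addrC addKr.
have := approx_onM ceta_le1 bounded_xfac bounded_phi h (approx_onxx _ _ _).
by apply: eq_approx_onl => w wok; rewrite phi_shift; ring.
Qed.

Local Notation X := (fun w => xfac (cx w)).
Local Notation tau := (fun w => tfac (ct w)).
Local Notation P := (fun w => ph (ct w) (cx w)).
Let bX : bnd X := bounded_xfac.
Let btau : bnd tau := bounded_tfac.
Let bP : bnd P := bounded_phi.

Lemma bounded_phi_x : bnd (fun w => phi_x (ct w) (cx w)).
Proof. by rewrite /phi_x; bounded_tac. Qed.
Lemma bounded_phi_t : bnd (fun w => phi_t (ct w) (cx w)).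
Proof. by rewrite /phi_t; bounded_tac. Qed.
Lemma bounded_phi_tt : bnd (fun w => phi_tt (ct w) (cx w)).
Proof. by rewrite /phi_tt; bounded_tac. Qed.
Lemma bounded_phi_xx : bnd (fun w => phi_xx (ct w) (cx w)).
Proof. by rewrite /phi_xx; bounded_tac. Qed.
Lemma bounded_phi_tx : bnd (fun w => phi_tx (ct w) (cx w)).
Proof. by rewrite /phi_tx; bounded_tac. Qed.

Let bx := bounded_phi_x.
Let bt := bounded_phi_t.
Let btt := bounded_phi_tt.
Let bxx := bounded_phi_xx.
Let btx := bounded_phi_tx.

Lemma xfac_shift : apx (fun w => xfac (cy w)) X.
Proof.
apply: eq_small_on (small_onMl (bounded_on_cst _ (2 * lam)) small_ch) => w _.
by rewrite /xfac /cy; ring.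
Qed.

Lemma phi_shift_approx : apx (fun w => ph (ct w) (cy w)) P.
Proof.
have bq := approx_bounded_on ceta_le1 bx phi_diff_quotient.
apply: eq_small_on (small_onMl bq small_ch) => w wok.
by rewrite divfK// ch_neq0.
Qed.

Ltac approx_tac := repeat match goal with
  | |- bounded_on _ _ => by bounded_tac
  | |- approx_on _ _ ?f ?f => exact: approx_onxx
  | |- approx_on _ _ (fun w => xfac (cy w)) _ => exact: xfac_shift
  | |- approx_on _ _ (fun w => phi _ _ _ _ _ (cy w)) _ => exact: phi_shift_approx
  | |- approx_on _ _ _ _ => first [assumption | apply: approx_onD | apply: approx_onN
    | apply: (approx_onM ceta_le1) ]
  end.

Lemma phi_x_shift : apx (fun w => phi_x (ct w) (cy w)) (fun w => phi_x (ct w) (cx w)).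
Proof. by rewrite /phi_x; approx_tac. Qed.
Lemma phi_t_shift : apx (fun w => phi_t (ct w) (cy w)) (fun w => phi_t (ct w) (cx w)).
Proof. by rewrite /phi_t; approx_tac. Qed.
Lemma phi_tt_shift : apx (fun w => phi_tt (ct w) (cy w)) (fun w => phi_tt (ct w) (cx w)).
Proof. by rewrite /phi_tt; approx_tac. Qed.
Lemma phi_tx_shift : apx (fun w => phi_tx (ct w) (cy w)) (fun w => phi_tx (ct w) (cx w)).
Proof. by rewrite /phi_tx; approx_tac. Qed.

Definition phi_x_slope w := (phi_x (ct w) (cy w) - phi_x (ct w) (cx w)) / ch w.

Lemma phi_x_slope_approx : apx phi_x_slope (fun w => phi_xx (ct w) (cx w)).
Proof.
have h : apx (fun w => X w * ((ph (ct w) (cy w) - P w) / ch w) + 2 * lam * ph (ct w) (cy w))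
             (fun w => X w * phi_x (ct w) (cx w) + 2 * lam * P w).
  by have dq := phi_diff_quotient; approx_tac.
apply: (approx_on_trans (eq_approx_onl _ h)) => [w wok|].
  by rewrite /phi_x_slope /phi_x /xfac /cy; field; exact: ch_neq0.
by apply: eq_small_on (approx_onxx _ _ (fun=> 0)) => w _; rewrite /phi_xx /phi_x; ring.
Qed.

Let bslope := approx_bounded_on ceta_le1 bxx phi_x_slope_approx.

Definition px_sum w := phi_x (ct w) (cy w) + phi_x (ct w) (cx w).

Lemma bounded_phi_x_shift : bnd (fun w => phi_x (ct w) (cy w)).
Proof. exact: (approx_bounded_on ceta_le1 bx phi_x_shift). Qed.
Let bxs := bounded_phi_x_shift.

Lemma bounded_px_sum : bnd px_sum.
Proof. by rewrite /px_sum; bounded_tac. Qed.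
Let bsum := bounded_px_sum.

Lemma px_sum_approx : apx px_sum (fun w => 2 * phi_x (ct w) (cx w)).
Proof.
have h := approx_onD phi_x_shift (approx_onxx cell_ok ceta (fun w => phi_x (ct w) (cx w))).
by apply: eq_small_on h => w _; rewrite /px_sum; ring.
Qed.

Let sml_half : sml (fun w => ceta w / 2).
Proof. by apply: small_onM; [exact: small_on_eta|exact: bounded_on_cst]. Qed.
Let sml_halfh : sml (fun w => ceta w * ch w / 2).
Proof.
by apply: small_onM; [apply: small_onM; [exact: small_on_eta|]|exact: bounded_on_cst];
  exact: (small_bounded_on ceta_le1 small_ch).
Qed.

(** The half-difference factor of [sinhRB] and [coshRB] for p at the two ends of a cell, normalised
    by its size s h^2 / 2; [sinh_sum] is the half-sum factor, normalised by s h / 2. *)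
Definition sinh_slope w := sinhR (ceta w * ch w / 2 * phi_x_slope w) / (ceta w * ch w / 2).

Lemma sinh_slope_approx : apx sinh_slope (fun w => phi_xx (ct w) (cx w)).
Proof.
apply: approx_on_trans phi_x_slope_approx.
apply: approx_sinhR_div => // w wok.
by rewrite mulf_neq0 ?invr_neq0// mulf_neq0 ?ceta_neq0 ?ch_neq0.
Qed.

Lemma acoef_approx : apx (fun w => acoef (ceta w) (ct w) (cx w)) (fun=> 1).
Proof. by apply: approx_coshR => //; exact: small_on_eta. Qed.
Lemma acoef_shift_approx : apx (fun w => acoef (ceta w) (ct w) (cy w)) (fun=> 1).
Proof. by apply: approx_coshR => //; exact: small_on_eta. Qed.
Lemma gcoef_approx : apx (fun w => gcoef (ceta w) (ct w) (cx w)) (fun w => phi_x (ct w) (cx w)).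
Proof. by apply: approx_sinhR_div => //; exact: small_on_eta. Qed.
Lemma gcoef_shift_approx :
  apx (fun w => gcoef (ceta w) (ct w) (cy w)) (fun w => phi_x (ct w) (cx w)).
Proof.
apply: approx_on_trans phi_x_shift.
by apply: approx_sinhR_div => //; exact: small_on_eta.
Qed.

Lemma coshR_sub1_half (y : R) : coshR y - 1 = 2 * sinhR (y / 2) ^+ 2.
Proof.
have := coshRB y 0; rewrite addr0 subr0.
have -> : coshR 0 = 1 :> R by rewrite /coshR oppr0 expR0; field.
by move=> ->; ring.
Qed.

(** [kcoef] divides by [e ^+ 2], and the quadratic bound on cosh - 1 would only show it bounded.
    Written as the square of a sinh quotient, it gets its limit from the first-order estimate. *)
Lemma kcoefE e t x : e != 0 -> kcoef e t x = (sinhR (e / 2 * phi_x t x) / (e / 2)) ^+ 2.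
Proof.
move=> e0; rewrite /kcoef coshR_sub1_half [e * _ / 2]mulrAC; field.
exact: e0.
Qed.

Lemma kcoef_approx :
  apx (fun w => kcoef (ceta w) (ct w) (cx w)) (fun w => phi_x (ct w) (cx w) ^+ 2).
Proof.
have h : apx (fun w => sinhR (ceta w / 2 * phi_x (ct w) (cx w)) / (ceta w / 2))
    (fun w => phi_x (ct w) (cx w)).
  by apply: approx_sinhR_div => // w wok; rewrite mulf_neq0 ?invr_neq0 ?ceta_neq0.
apply: eq_approx_onl (approx_onM ceta_le1 bx bx h h) => w wok.
by rewrite kcoefE ?ceta_neq0// expr2.
Qed.

Lemma kcoef_shift_approx :
  apx (fun w => kcoef (ceta w) (ct w) (cy w)) (fun w => phi_x (ct w) (cx w) ^+ 2).
Proof.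
have h : apx (fun w => sinhR (ceta w / 2 * phi_x (ct w) (cy w)) / (ceta w / 2))
    (fun w => phi_x (ct w) (cx w)).
  apply: approx_on_trans phi_x_shift.
  by apply: approx_sinhR_div => // w wok; rewrite mulf_neq0 ?invr_neq0 ?ceta_neq0.
apply: eq_approx_onl (approx_onM ceta_le1 bx bx h h) => w wok.
by rewrite kcoefE ?ceta_neq0// expr2.
Qed.

Definition slope (F : R -> R -> R -> R) w :=
  (F (ceta w) (ct w) (cy w) - F (ceta w) (ct w) (cx w)) / ch w.

Lemma half_sum_px w : (ceta w * phi_x (ct w) (cy w) + ceta w * phi_x (ct w) (cx w)) / 2 =
  ceta w / 2 * px_sum w.
Proof. by rewrite /px_sum; field. Qed.

Lemma half_diff_px w : cell_ok w ->
  (ceta w * phi_x (ct w) (cy w) - ceta w * phi_x (ct w) (cx w)) / 2 =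
  ceta w * ch w / 2 * phi_x_slope w.
Proof. by move=> wok; rewrite /phi_x_slope; field; exact: ch_neq0. Qed.

Definition sinh_sum w := sinhR (ceta w / 2 * px_sum w) / (ceta w / 2).

Lemma sinh_sum_approx : apx sinh_sum (fun w => 2 * phi_x (ct w) (cx w)).
Proof.
apply: approx_on_trans px_sum_approx.
by apply: approx_sinhR_div => // w wok; rewrite mulf_neq0 ?invr_neq0 ?ceta_neq0.
Qed.

Let b2x : bnd (fun w => 2 * phi_x (ct w) (cx w)). Proof. by bounded_tac. Qed.
Let bss := approx_bounded_on ceta_le1 b2x sinh_sum_approx.
Let bsl := approx_bounded_on ceta_le1 bxx sinh_slope_approx.

Lemma gcoef_slope_approx : apx (slope gcoef) (fun w => phi_xx (ct w) (cx w)).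
Proof.
have hc : apx (fun w => coshR (ceta w / 2 * px_sum w)) (fun=> 1) by exact: approx_coshR.
have := approx_onM ceta_le1 (bounded_on_cst _ 1) bxx hc sinh_slope_approx.
move=> h; apply: approx_on_trans (eq_approx_onl _ h) _ => [w wok|].
  rewrite /slope /gcoef -mulrBl sinhRB half_sum_px half_diff_px// /sinh_slope.
  by field; rewrite ch_neq0// ceta_neq0.
by apply: eq_small_on (approx_onxx _ _ (fun=> 0)) => w _; ring.
Qed.

Lemma kcoef_slope_approx : apx (slope kcoef)
  (fun w => 2 * phi_x (ct w) (cx w) * phi_xx (ct w) (cx w)).
Proof.
apply: eq_approx_onl (approx_onM ceta_le1 b2x bxx sinh_sum_approx sinh_slope_approx) => w wok.
transitivity (2 * (coshR (ceta w * phi_x (ct w) (cy w)) -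
  coshR (ceta w * phi_x (ct w) (cx w))) / ceta w ^+ 2 / ch w); last first.
  rewrite /slope /kcoef.
  by move: (coshR _) (coshR _) ((ch w)^-1) => c1 c2 k; ring.
rewrite coshRB half_sum_px half_diff_px// /sinh_slope /sinh_sum.
by field; rewrite ch_neq0// ceta_neq0.
Qed.

(** Both factors of the cosh increment are of order e and nothing is divided by e here, so the slope
    is even O(e^2): cosh p is invisible in the limit form. *)
Lemma acoef_slope_small : sml (slope acoef).
Proof.
have h : sml (fun w => ceta w * (ceta w / 2 * (sinh_sum w * sinh_slope w))).
  apply: small_onM; first exact: small_on_eta.
  by have be := small_bounded_on ceta_le1 (small_on_eta cell_ok ceta); bounded_tac.
apply: eq_small_on h => w wok.
rewrite /slope /acoef coshRB half_sum_px half_diff_px// /sinh_slope /sinh_sum.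
by field; rewrite ch_neq0// ceta_neq0.
Qed.

Lemma phi_t_slope_approx : apx (slope (fun=> phi_t)) (fun w => phi_tx (ct w) (cx w)).
Proof.
have := approx_onM ceta_le1 btau bx (approx_onxx _ _ _) phi_diff_quotient.
move=> h; apply: approx_on_trans (eq_approx_onl _ h) _ => [w wok|].
  by rewrite /slope /phi_t; ring.
by apply: eq_small_on (approx_onxx _ _ (fun=> 0)) => w _; rewrite /phi_tx /phi_x; ring.
Qed.

Let b1 := bounded_on_cst cell_ok (1 : R).
Let ba := approx_bounded_on ceta_le1 b1 acoef_approx.
Let bas := approx_bounded_on ceta_le1 b1 acoef_shift_approx.
Let bg := approx_bounded_on ceta_le1 bx gcoef_approx.
Let bgs := approx_bounded_on ceta_le1 bx gcoef_shift_approx.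

Lemma slopeM F G w : slope (fun e t x => F e t x * G e t x) w =
  F (ceta w) (ct w) (cy w) * slope G w + slope F w * G (ceta w) (ct w) (cx w).
Proof. by rewrite /slope; ring. Qed.

Lemma approx_slopeM_a F f : bnd f -> apx (slope F) f ->
  bnd (fun w => F (ceta w) (ct w) (cx w)) ->
  apx (slope (fun e t x => acoef e t x * F e t x)) f.
Proof.
move=> bf hF bF.
have h1 := approx_onM ceta_le1 b1 bf acoef_shift_approx hF.
have h2 := small_onM acoef_slope_small bF.
by apply: eq_small_on (small_onD h1 h2) => w _; rewrite slopeM; ring.
Qed.

Lemma fcoef_slope_approx : apx (slope fcoef) (fun w => phi_tx (ct w) (cx w)).
Proof. exact: (approx_slopeM_a (F := fun=> phi_t) btx phi_t_slope_approx bt). Qed.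

Lemma agcoef_slope_approx :
  apx (slope (fun e t x => acoef e t x * gcoef e t x)) (fun w => phi_xx (ct w) (cx w)).
Proof. exact: (approx_slopeM_a bxx gcoef_slope_approx bg). Qed.

Lemma bounded_agcoef_shift :
  bnd (fun w => acoef (ceta w) (ct w) (cy w) * gcoef (ceta w) (ct w) (cy w)).
Proof. exact: bounded_onM. Qed.

Lemma gcoef_t_approx :
  apx (fun w => gcoef_t (ceta w) (ct w) (cx w)) (fun w => phi_tx (ct w) (cx w)).
Proof.
have h := approx_onM ceta_le1 b1 btx acoef_approx (approx_onxx _ _ _).
by apply: eq_small_on h => w _; rewrite mul1r.
Qed.

Lemma gcoef_t_shift_approx :
  apx (fun w => gcoef_t (ceta w) (ct w) (cy w)) (fun w => phi_tx (ct w) (cx w)).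
Proof.
have h := approx_onM ceta_le1 b1 btx acoef_shift_approx phi_tx_shift.
by apply: eq_small_on h => w _; rewrite mul1r.
Qed.

Let bxt_s := approx_bounded_on ceta_le1 btx phi_tx_shift.
Let bt_s := approx_bounded_on ceta_le1 bt phi_t_shift.
Let btt_s := approx_bounded_on ceta_le1 btt phi_tt_shift.

Lemma acoef_tE e t x : e != 0 -> acoef_t e t x = e * (e * (gcoef e t x * phi_tx t x)).
Proof. by move=> e0; rewrite /acoef_t /gcoef; field. Qed.

Lemma fcoef_t_approx :
  apx (fun w => fcoef_t (ceta w) (ct w) (cx w)) (fun w => phi_tt (ct w) (cx w)).
Proof.
have h1 := approx_onM ceta_le1 b1 btt acoef_approx (approx_onxx _ _ _).
have h2 : sml (fun w => ceta w * (ceta w * (gcoef (ceta w) (ct w) (cx w) *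
    phi_tx (ct w) (cx w)) * phi_t (ct w) (cx w))).
  apply: small_onM; first exact: small_on_eta.
  by have be := small_bounded_on ceta_le1 (small_on_eta cell_ok ceta); bounded_tac.
apply: eq_small_on (small_onD h1 h2) => w wok.
by rewrite /fcoef_t acoef_tE ?ceta_neq0//; ring.
Qed.

Lemma fcoef_t_shift_approx :
  apx (fun w => fcoef_t (ceta w) (ct w) (cy w)) (fun w => phi_tt (ct w) (cx w)).
Proof.
have h1 := approx_onM ceta_le1 b1 btt acoef_shift_approx phi_tt_shift.
have h2 : sml (fun w => ceta w * (ceta w * (gcoef (ceta w) (ct w) (cy w) *
    phi_tx (ct w) (cy w)) * phi_t (ct w) (cy w))).
  apply: small_onM; first exact: small_on_eta.
  by have be := small_bounded_on ceta_le1 (small_on_eta cell_ok ceta); bounded_tac.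
apply: eq_small_on (small_onD h1 h2) => w wok.
by rewrite /fcoef_t acoef_tE ?ceta_neq0//; ring.
Qed.

Ltac approx_atoms_tac := repeat match goal with
  | |- bounded_on _ _ => by bounded_tac
  | |- approx_on _ _ ?f ?f => exact: approx_onxx
  | |- approx_on _ _ (fun w => _ + _) _ => apply: approx_onD
  | |- approx_on _ _ (fun w => - _) _ => apply: approx_onN
  | |- approx_on _ _ (fun w => _ * _) _ => apply: (approx_onM ceta_le1)
  | |- approx_on _ _ _ _ => assumption
  end.

Let hg := gcoef_approx.
Let hgs := gcoef_shift_approx.
Let hk := kcoef_approx.
Let hks := kcoef_shift_approx.
Let hts := phi_t_shift.
Let htts := phi_tt_shift.
Let htxs := phi_tx_shift.

Lemma zcoef_t_approx :
  apx (fun w => zcoef_t (ceta w) (ct w) (cx w)) (fun w => zlead_t (ct w) (cx w)).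
Proof.
rewrite /zcoef_t /zlead_t /mcoef_t /mcoef /kcoef_t.
under [X in approx_on _ _ X _]eq_fun do rewrite expr2.
under [X in approx_on _ _ _ X]eq_fun do rewrite (expr2 (phi_t _ _)).
approx_atoms_tac.
Qed.

Lemma zcoef_t_shift_approx :
  apx (fun w => zcoef_t (ceta w) (ct w) (cy w)) (fun w => zlead_t (ct w) (cx w)).
Proof.
rewrite /zcoef_t /zlead_t /mcoef_t /mcoef /kcoef_t.
under [X in approx_on _ _ X _]eq_fun do rewrite expr2.
under [X in approx_on _ _ _ X]eq_fun do rewrite (expr2 (phi_t _ _)).
approx_atoms_tac.
Qed.

Lemma mgcoef_slope_approx :
  apx (slope (fun e t x => mcoef e t x * gcoef e t x)) (fun w => zlead_x (ct w) (cx w)).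
Proof.
have ht := phi_t_slope_approx; have hgl := gcoef_slope_approx.
have hkl := kcoef_slope_approx.
have h : apx (fun w => ((phi_t (ct w) (cy w) + phi_t (ct w) (cx w)) * slope (fun=> phi_t) w
     - slope kcoef w) * gcoef (ceta w) (ct w) (cx w)
   + (phi_t (ct w) (cy w) * phi_t (ct w) (cy w) - kcoef (ceta w) (ct w) (cy w)) * slope gcoef w)
  (fun w => ((phi_t (ct w) (cx w) + phi_t (ct w) (cx w)) * phi_tx (ct w) (cx w)
     - 2 * phi_x (ct w) (cx w) * phi_xx (ct w) (cx w)) * phi_x (ct w) (cx w)
   + (phi_t (ct w) (cx w) * phi_t (ct w) (cx w) - phi_x (ct w) (cx w) ^+ 2) * phi_xx (ct w) (cx w)).
  approx_atoms_tac.
apply: eq_small_on h => w wok; rewrite slopeM.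
have -> : slope mcoef w = (phi_t (ct w) (cy w) + phi_t (ct w) (cx w)) *
    slope (fun=> phi_t) w - slope kcoef w.
  rewrite /slope /mcoef.
  by move: (phi_t _ _) (phi_t _ _) (kcoef _ _ _) (kcoef _ _ _) ((ch w)^-1) => *; ring.
by rewrite /mcoef /zlead_x; ring.
Qed.

End Approximations.

(** * Coercivity of the edge form *)

Lemma lead_quadratic_ge t x (a d : R) : 0 <= lam -> beta <= 1 -> 1 <= ph t x ->
  2 * lam * (1 - beta) * (a ^+ 2 + d ^+ 2) <=
  (phi_tt t x + phi_xx t x) * (a ^+ 2 + d ^+ 2) - 4 * phi_tx t x * a * d.
Proof.
move=> l0 b1 p1; rewrite /phi_tt /phi_xx /phi_tx.
set X := xfac x; set tau := tfac t; set p := ph t x.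
(* The part quadratic in lambda is a sum of two squares; what remains is lambda (psi_tt + psi_xx) =
   2 lambda (1 - beta), the source of coercivity in v_t and d. *)
have -> : ((tau ^+ 2 - 2 * lam * beta) * p + (X ^+ 2 + 2 * lam) * p) *
    (a ^+ 2 + d ^+ 2) - 4 * (X * tau * p) * a * d =
  p * (2 * lam * (1 - beta) * (a ^+ 2 + d ^+ 2) +
       ((tau * a - X * d) ^+ 2 + (tau * d - X * a) ^+ 2)) by ring.
have h1 : 0 <= 2 * lam * (1 - beta) * (a ^+ 2 + d ^+ 2).
  by rewrite !mulr_ge0 ?subr_ge0 ?addr_ge0 ?sqr_ge0.
have h2 : 0 <= (tau * a - X * d) ^+ 2 + (tau * d - X * a) ^+ 2.
  by rewrite addr_ge0 ?sqr_ge0.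
rewrite -/p in p1; nra.
Qed.

(* With [z = tfac t ^+ 2 - xfac x ^+ 2], completing the square gives
   [3 * z ^+ 2 - 2 * lam * (1 + 3 * beta) * z >= - lam ^+ 2 * (1 + 3 * beta) ^+ 2 / 3],
   which the term in [xfac x ^+ 2] absorbs for [lam] above the threshold. *)
Lemma zlead_ge t x : 0 < lam -> 0 < beta -> beta < 1 -> x0 < 0 -> 0 <= x ->
  1 <= ph t x -> 1 <= lam * (1 - beta) * x0 ^+ 2 ->
  lam ^+ 2 <= zlead_t t x - zlead_x t x.
Proof.
move=> l0 b0 b1 x00 x_0 p1 lb.
have -> : zlead_t t x - zlead_x t x = ph t x ^+ 3 *
  (3 * (tfac t ^+ 2 - xfac x ^+ 2) ^+ 2 +
   2 * lam * (2 * (1 - beta) * xfac x ^+ 2 -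
     (1 + 3 * beta) * (tfac t ^+ 2 - xfac x ^+ 2))).
  rewrite /zlead_t /zlead_x /phi_t /phi_x /phi_tt /phi_xx /phi_tx; ring.
set z := tfac t ^+ 2 - _.
have hX : 4 * lam ^+ 2 * x0 ^+ 2 <= xfac x ^+ 2.
  have -> : 4 * lam ^+ 2 * x0 ^+ 2 = (2 * lam * - x0) ^+ 2 by ring.
  rewrite /xfac lerXn2r ?nnegrE ?mulr_ge0//; [lra|lra|lra|lra|].
  by rewrite ler_wpM2l//; [apply: mulr_ge0; lra|lra].
have hq : 3 * z ^+ 2 - 2 * lam * (1 + 3 * beta) * z >= - (lam ^+ 2 * (16 / 3)).
  have -> : 3 * z ^+ 2 - 2 * lam * (1 + 3 * beta) * z =
    3 * (z - lam * (1 + 3 * beta) / 3) ^+ 2 - lam ^+ 2 * ((1 + 3 * beta) ^+ 2 / 3) by field.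
  have := sqr_ge0 (z - lam * (1 + 3 * beta) / 3).
  have : lam ^+ 2 * ((1 + 3 * beta) ^+ 2 / 3) <= lam ^+ 2 * (16 / 3).
    rewrite ler_wpM2l ?sqr_ge0// ler_pM2r//.
    have -> : (1 + 3 * beta) ^+ 2 = 1 + 6 * beta + 9 * (beta * beta) by ring.
    nra.
  lra.
have hl : 16 * lam ^+ 2 <= 4 * lam * (1 - beta) * xfac x ^+ 2.
  apply: (@le_trans _ _ (4 * lam * (1 - beta) * (4 * lam ^+ 2 * x0 ^+ 2))).
    have -> : 4 * lam * (1 - beta) * (4 * lam ^+ 2 * x0 ^+ 2) =
      16 * lam ^+ 2 * (lam * (1 - beta) * x0 ^+ 2) by ring.
    by rewrite ler_peMr// mulr_ge0// sqr_ge0.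
  by rewrite ler_wpM2l// !mulr_ge0//; lra.
have l2 := sqr_ge0 lam.
have p3 : 1 <= ph t x ^+ 3 by exact: exprn_ege1.
set q := 3 * z ^+ 2 + _.
have hq2 : lam ^+ 2 <= q.
  rewrite /q; clear q; clearbody z.
  lra.
have q0 := le_trans l2 hq2.
by apply: le_trans hq2 _; apply: ler_peMl.
Qed.

(* [d] stands for [diff_plus v], [u] for [v_t] and [V] for [s v] at the left end
   of an edge, [u'] and [V'] at its right end. *)
Definition edge_form w (u u' d V V' : R) : R :=
  let e := ceta w in let t := ct w in let x := cx w in let y := cy w in
  (phi_tt t x * u ^+ 2 + phi_tt t y * u' ^+ 2) / 2
  - (gcoef_t e t x * u + gcoef_t e t y * u') * d
  + slope gcoef w * (u * u') - slope fcoef w * (u + u') * d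
  + (fcoef_t e t x + fcoef_t e t y) / 2 * d ^+ 2
  + slope (fun e t x => acoef e t x * gcoef e t x) w * d ^+ 2
  + (zcoef_t e t x * V ^+ 2 + zcoef_t e t y * V' ^+ 2) / 2
  - slope (fun e t x => mcoef e t x * gcoef e t x) w * (V * V').

Definition edge_lead w (u u' d V V' : R) : R :=
  let t := ct w in let x := cx w in
  (phi_tt t x * u ^+ 2 + phi_tt t x * u' ^+ 2) / 2
  - (phi_tx t x * u + phi_tx t x * u') * d
  + phi_xx t x * (u * u') - phi_tx t x * (u + u') * d
  + (phi_tt t x + phi_tt t x) / 2 * d ^+ 2 + phi_xx t x * d ^+ 2
  + (zlead_t t x * V ^+ 2 + zlead_t t x * V' ^+ 2) / 2
  - zlead_x t x * (V * V').

Lemma edge_form_lead : exists C, 0 <= C /\ forall w, cell_ok w -> forall u u' d V V',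
  `|edge_form w u u' d V V' - edge_lead w u u' d V V'| <=
  C * `|ceta w| * (u ^+ 2 + u' ^+ 2 + d ^+ 2 + V ^+ 2 + V' ^+ 2).
Proof.
have [C1 H1] := phi_tt_shift.
have [C2 H2] := gcoef_t_approx.
have [C3 H3] := gcoef_t_shift_approx.
have [C4 H4] := gcoef_slope_approx.
have [C5 H5] := fcoef_slope_approx.
have [C6 H6] := fcoef_t_approx.
have [C7 H7] := fcoef_t_shift_approx.
have [C8 H8] := agcoef_slope_approx.
have [C9 H9] := zcoef_t_approx.
have [C10 H10] := zcoef_t_shift_approx.
have [C11 H11] := mgcoef_slope_approx.
pose Cs := [:: C1; C2; C3; C4; C5; C6; C7; C8; C9; C10; C11].
pose c := \sum_(x <- Cs) `|x|.
(* The two forms differ by twelve products, each with a coefficient off by at most c |s h| and a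
   weight of at most 1. *)
exists (12 * c); split; first by rewrite mulr_ge0// sumr_ge0.
move=> w wok u u' d V V'.
pose K := c * `|ceta w|.
have le (n : nat) (e : R) : `|e| <= Cs`_n * `|ceta w| -> (n < size Cs)%N -> `|e| <= K.
  move=> h nC; apply: le_trans h _; rewrite ler_wpM2r//.
  apply: le_trans (ler_norm _) _.
  by rewrite /c (big_rem Cs`_n) ?mem_nth//= lerDl sumr_ge0.
pose S := u ^+ 2 + u' ^+ 2 + d ^+ 2 + V ^+ 2 + V' ^+ 2.
have nm (e p : R) : `|e| <= K -> `|p| <= S -> - (K * S) <= e * p <= K * S.
  by move=> he hp; rewrite -ler_norml normrM ler_pM.
have sq : [/\ 0 <= u ^+ 2, 0 <= u' ^+ 2, 0 <= d ^+ 2, 0 <= V ^+ 2 & 0 <= V' ^+ 2].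
  by split; exact: sqr_ge0.
have prod (a b : R) : `|a * b| <= (a ^+ 2 + b ^+ 2) / 2.
  rewrite ler_norml; have := sqr_ge0 (a - b); have := sqr_ge0 (a + b).
  by rewrite sqrrB sqrrD; lra.
have sqn (a : R) : `|a ^+ 2| = a ^+ 2 by rewrite ger0_norm ?sqr_ge0.
have [q1 q2 q3 q4 q5] := sq.
have S1 : `|u' ^+ 2| <= S by rewrite sqn /S; lra.
have S2 : `|u * d| <= S by apply: le_trans (prod _ _) _; rewrite /S; lra.
have S3 : `|u' * d| <= S by apply: le_trans (prod _ _) _; rewrite /S; lra.
have S4 : `|u * u'| <= S by apply: le_trans (prod _ _) _; rewrite /S; lra.
have S5 : `|d ^+ 2| <= S by rewrite sqn /S; lra.
have S6 : `|V ^+ 2| <= S by rewrite sqn /S; lra.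
have S7 : `|V' ^+ 2| <= S by rewrite sqn /S; lra.
have S8 : `|V * V'| <= S by apply: le_trans (prod _ _) _; rewrite /S; lra.
have L n (e : R) : `|e| <= Cs`_n * `|ceta w| -> (n < size Cs)%N ->
   forall p : R, `|p| <= S -> - (K * S) <= e * p <= K * S.
  by move=> he hn p hp; apply: nm => //; exact: le he hn.
have := L 0%N _ (H1 w wok) isT _ S1.
have := L 1%N _ (H2 w wok) isT _ S2.
have := L 2%N _ (H3 w wok) isT _ S3.
have := L 3%N _ (H4 w wok) isT _ S4.
have := L 4%N _ (H5 w wok) isT _ S2.
have := L 4%N _ (H5 w wok) isT _ S3.
have := L 5%N _ (H6 w wok) isT _ S5.
have := L 6%N _ (H7 w wok) isT _ S5.
have := L 7%N _ (H8 w wok) isT _ S5.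
have := L 8%N _ (H9 w wok) isT _ S6.
have := L 9%N _ (H10 w wok) isT _ S7.
have := L 10%N _ (H11 w wok) isT _ S8.
have -> : 12 * c * `|ceta w| * (u ^+ 2 + u' ^+ 2 + d ^+ 2 + V ^+ 2 + V' ^+ 2) =
  12 * (K * S) by rewrite /K /S; ring.
rewrite /edge_form /edge_lead ler_norml.
move: (K * S) => KS.
move: (slope _ w) (slope _ w) (slope _ w) (slope _ w) => r1 r2 r3 r4.
move: (zcoef_t _ _ _) (zcoef_t _ _ _) (fcoef_t _ _ _) (fcoef_t _ _ _) => r5 r6 r7 r8.
move: (gcoef_t _ _ _) (gcoef_t _ _ _) (zlead_t _ _) (zlead_x _ _) => r9 r10 r11 r12.
move: (phi_tt _ _) (phi_tt _ _) (phi_xx _ _) (phi_tx _ _) => r13 r14 r15 r16; clear.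
move=> /andP[? ?] /andP[? ?] /andP[? ?] /andP[? ?] /andP[? ?] /andP[? ?].
move=> /andP[? ?] /andP[? ?] /andP[? ?] /andP[? ?] /andP[? ?] /andP[? ?].
apply/andP; split; lra.
Qed.

(** * Ratios of the weights at neighbouring nodes *)

Section Residual.

Let sml_ch : sml ch.
Proof. exact: small_ch. Qed.
Let bh : bnd ch := small_bounded_on ceta_le1 sml_ch.
Let be : bnd ceta := small_bounded_on ceta_le1 (small_on_eta _ _).
Let bX : bnd (fun w => xfac (cx w)) := bounded_xfac.
Let bP : bnd (fun w => ph (ct w) (cx w)) := bounded_phi.

Lemma bounded_expR_taylor2 c y : bnd y -> sml c -> (forall w, cell_ok w -> c w != 0) ->
  bnd (fun w => (expR (c w * y w) - 1 - c w * y w) / c w ^+ 2).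
Proof.
move=> by_ sc c0.
have [C HC] := bounded_onM (bounded_onX 2 by_) (bounded_on_expR (bounded_on_norm
  (bounded_onM (small_bounded_on ceta_le1 sc) by_))).
exists C => w wok; rewrite normrM normfV normrX ler_pdivrMr ?exprn_gt0 ?normr_gt0 ?c0//.
apply: le_trans (expR_sub1_bound _) _.
have n2 : `|c w| ^+ 2 = c w ^+ 2 by rewrite -normrX ger0_norm ?sqr_ge0.
rewrite n2 exprMn -mulrA mulrC ler_wpM2r ?sqr_ge0//.
exact: le_trans (ler_norm _) (HC w wok).
Qed.

Definition phi_quot w := (ph (ct w) (cy w) - ph (ct w) (cx w)) / ch w.

Lemma phi_quot_bounded : bnd phi_quot.
Proof.
exact: (approx_bounded_on ceta_le1 (bounded_phi_x)
  (phi_diff_quotient)).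
Qed.

Lemma phi_quot_remainder : bnd (fun w => (phi_quot w - phi_x (ct w) (cx w)) / ch w).
Proof.
have by_ : bnd (fun w => xfac (cx w) + lam * ch w) by bounded_tac.
have bt := bounded_expR_taylor2 by_ sml_ch ch_neq0.
have : bnd (fun w => ph (ct w) (cx w) * ((expR (ch w * (xfac (cx w) + lam * ch w)) - 1 -
    ch w * (xfac (cx w) + lam * ch w)) / ch w ^+ 2 + lam)) by bounded_tac.
apply: eq_bounded_on => w wok.
rewrite /phi_quot phi_shift /phi_x; field; exact: ch_neq0.
Qed.

Let bq := phi_quot_bounded.
Let bqr := phi_quot_remainder.
Let bx := bounded_phi_x.

(** The quotient of e^(s phi) at [cx w] by its value at [cy w]: the factor that re-expresses a
    neighbouring value of w, weighted at the node, through v. *)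
Definition weight_ratio w := expR (- (cs w * (ph (ct w) (cy w) - ph (ct w) (cx w)))).

Lemma weight_ratioE w : cell_ok w -> weight_ratio w = expR (ceta w * - phi_quot w).
Proof.
move=> wok; rewrite /weight_ratio /phi_quot /ceta; congr expR; field.
exact: ch_neq0.
Qed.

Lemma weight_ratio_sub1 : bnd (fun w => (weight_ratio w - 1) / ceta w).
Proof.
have bnq : bnd (fun w => - phi_quot w) by bounded_tac.
have h := approx_expR_sub1_div ceta_le1 bnq (small_on_eta _ _) ceta_neq0.
apply: eq_bounded_on (approx_bounded_on ceta_le1 bnq h) => w wok.
by rewrite weight_ratioE.
Qed.

(** The two exponents differ by s h^2 times a bounded quantity. After the division by h^2 in the
    Laplacian this leaves an error O(s) |v|. *)
Lemma weight_ratio_taylor :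
  bnd (fun w => (weight_ratio w - expR (- (ceta w * phi_x (ct w) (cx w)))) / (cs w * ch w ^+ 2)).
Proof.
pose c w := ceta w * ch w.
have sc : sml c by apply: small_onM => //; exact: small_on_eta.
have c0 w : cell_ok w -> c w != 0 by move=> wok; rewrite mulf_neq0 ?ceta_neq0 ?ch_neq0.
pose y w := - ((phi_quot w - phi_x (ct w) (cx w)) / ch w).
have by_ : bnd y by rewrite /y; exact: bounded_onN.
have h := approx_bounded_on ceta_le1 by_ (approx_expR_sub1_div ceta_le1 by_ sc c0).
have bex : bnd (fun w => expR (- (ceta w * phi_x (ct w) (cx w)))).
  by apply: bounded_on_expR; bounded_tac.
apply: eq_bounded_on (bounded_onM bex h) => w wok.
rewrite /c {2}/ceta -[cs w * ch w * ch w]mulrA -expr2 mulrA; congr (_ / _).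
rewrite mulrBr mulr1 -expRD weight_ratioE//; congr (expR _ - _).
rewrite /y /ceta.
field; exact: ch_neq0.
Qed.

End Residual.

Section EdgeCoercive.
Hypotheses (lam_gt0 : 0 < lam) (beta_gt0 : 0 < beta) (beta_lt1 : beta < 1) (x0_lt0 : x0 < 0).
Hypothesis lam_ge : 1 <= lam * (1 - beta) * x0 ^+ 2.

Hypothesis phi_ge1 : forall w, cell_ok w -> 1 <= ph (ct w) (cx w).

(** In the mean a and the jump r = u' - u one has (u^2 + u'^2) / 2 = a^2 + r^2 / 4 and u u' = a^2 -
    r^2 / 4, so the limit form is the coercive form in (a, d) plus a multiple of r^2. The analogous
    jump of V equals s h d and is absorbed by d^2; nothing comparable controls r, hence the term
    with [K]. *)
Lemma edge_coercive : exists c eps K, [/\ 0 < c, 0 < eps, eps <= 1 & 0 <= K] /\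
  forall w, cell_ok w -> `|ceta w| <= eps ->
  forall u u' d V V', V' - V = ceta w * d ->
  c * (u ^+ 2 + u' ^+ 2 + d ^+ 2 + V ^+ 2 + V' ^+ 2) - K * (u' - u) ^+ 2 <=
  edge_form w u u' d V V'.
Proof.
have [C [C_ge0 HC]] := edge_form_lead.
have bxx := bounded_phi_xx.
have btt := bounded_phi_tt.
have btx := bounded_phi_tx.
have bt := bounded_phi_t.
have bx := bounded_phi_x.
have [K1 HK1] : bnd (fun w => phi_tt (ct w) (cx w) - phi_xx (ct w) (cx w)) by bounded_tac.
have [K2 HK2] : bnd (fun w => zlead_x (ct w) (cx w)) by rewrite /zlead_x; bounded_tac.
pose c0 := 2 * lam * (1 - beta).
have c0_gt0 : 0 < c0 by rewrite /c0 !mulr_gt0 ?subr_gt0.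
(* Going back from a^2 and (V^2 + V'^2) / 2 to the separate squares halves both constants and costs
   c0 r^2 / 4, the first part of [K]. *)
pose c1 := Num.min (c0 / 2) (lam ^+ 2 / 2).
have l2 : 0 < lam ^+ 2 by rewrite exprn_gt0.
have c1_gt0 : 0 < c1 by rewrite lt_min; apply/andP; split; lra.
have c1_le : c1 <= c0 / 2 /\ c1 <= lam ^+ 2 / 2 by rewrite !ge_min !lexx orbT.
(* [C] is the price of replacing the coefficients by their limits, [K2] that of the jump of V, and 1
   makes [D] positive. The choice of [eps] keeps D |s h| below c1 / 2, which leaves half of [c1]. *)
pose D := C + `|K2| + 1.
have D_gt0 : 0 < D by rewrite /D; have := normr_ge0 K2; lra.
exists (c1 / 2), (Num.min 1 (c1 / 2 / D)), (c0 / 4 + `|K1| / 4); split.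
  split; rewrite ?lt_min ?ltr01 ?divr_gt0// ?ge_min ?lexx//.
  by have := normr_ge0 K1; lra.
move=> w wok; rewrite le_min => /andP[e1 e2] u u' d V V' VV.
pose S := u ^+ 2 + u' ^+ 2 + d ^+ 2 + V ^+ 2 + V' ^+ 2; rewrite -/S.
have [t1 /andP[x_0 x_1] _ _ _] := wok.
have p1 := phi_ge1 wok.
have q1 := @lead_quadratic_ge (ct w) (cx w) ((u + u') / 2) d
  (ltW lam_gt0) (ltW beta_lt1) p1.
have q2 := zlead_ge lam_gt0 beta_gt0 beta_lt1 x0_lt0 x_0 p1 lam_ge.
have q3 := HC w wok u u' d V V'; rewrite -/S in q3.
have leadE : edge_lead w u u' d V V' =
  ((phi_tt (ct w) (cx w) + phi_xx (ct w) (cx w)) * (((u + u') / 2) ^+ 2 + d ^+ 2)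
    - 4 * phi_tx (ct w) (cx w) * ((u + u') / 2) * d)
  + (phi_tt (ct w) (cx w) - phi_xx (ct w) (cx w)) * ((u' - u) ^+ 2 / 4)
  + (zlead_t (ct w) (cx w) - zlead_x (ct w) (cx w)) * ((V ^+ 2 + V' ^+ 2) / 2)
  + zlead_x (ct w) (cx w) * ((V' - V) ^+ 2 / 2).
  by rewrite /edge_lead; field.
have du_ge0 := sqr_ge0 (u' - u).
have [u0 u'0 d0 V0 V'0] : [/\ 0 <= u ^+ 2, 0 <= u' ^+ 2, 0 <= d ^+ 2, 0 <= V ^+ 2 & 0 <= V' ^+ 2].
  by split; exact: sqr_ge0.
have h2 : - (`|K1| * ((u' - u) ^+ 2 / 4)) <=
    (phi_tt (ct w) (cx w) - phi_xx (ct w) (cx w)) * ((u' - u) ^+ 2 / 4).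
  rewrite -mulNr ler_wpM2r ?divr_ge0//.
  have /ler_normlP[hK1 _] := le_trans (HK1 w wok) (ler_norm _); lra.
have h3 : lam ^+ 2 * ((V ^+ 2 + V' ^+ 2) / 2) <=
    (zlead_t (ct w) (cx w) - zlead_x (ct w) (cx w)) * ((V ^+ 2 + V' ^+ 2) / 2).
  by rewrite ler_wpM2r// divr_ge0// addr_ge0.
have eta_sq : ceta w ^+ 2 <= `|ceta w|.
  by rewrite -[X in X <= _](ger0_norm (sqr_ge0 _)) normrX expr2 ler_piMr.
have dS : d ^+ 2 <= S by rewrite /S; lra.
have h4 : - (`|K2| * (`|ceta w| * S)) <= zlead_x (ct w) (cx w) * ((V' - V) ^+ 2 / 2).
  apply: (@le_trans _ _ (- `|K2| * ((V' - V) ^+ 2 / 2))).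
    rewrite mulNr lerN2 ler_wpM2l// VV exprMn.
    apply: (@le_trans _ _ (ceta w ^+ 2 * d ^+ 2)).
      by have := mulr_ge0 (sqr_ge0 (ceta w)) d0; lra.
    by apply: ler_pM => //; exact: sqr_ge0.
  rewrite ler_wpM2r ?divr_ge0 ?sqr_ge0//.
  have /ler_normlP[hK2 _] := le_trans (HK2 w wok) (ler_norm _); lra.
have h5 : D * (`|ceta w| * S) <= c1 / 2 * S.
  have S0 : 0 <= S by rewrite /S; lra.
  by rewrite mulrA ler_wpM2r// mulrC -ler_pdivlMr.
have h6 : 0 <= `|ceta w| * S by rewrite mulr_ge0// /S; lra.
have h7 : c0 * (((u + u') / 2) ^+ 2 + d ^+ 2) + lam ^+ 2 * ((V ^+ 2 + V' ^+ 2) / 2) >=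
    c1 * S - c0 / 4 * (u' - u) ^+ 2.
  have -> : ((u + u') / 2) ^+ 2 = (u ^+ 2 + u' ^+ 2) / 2 - (u' - u) ^+ 2 / 4 by field.
  have [m1 m2] := c1_le; rewrite /S.
  have := ler_wpM2r u0 m1; have := ler_wpM2r u'0 m1; have := ler_wpM2r d0 m1.
  have := ler_wpM2r V0 m2; have := ler_wpM2r V'0 m2; have := mulr_ge0 (ltW c0_gt0) d0.
  clear q1 q2 q3 h2 h3 h4 h5 h6 eta_sq dS HC HK1 HK2 leadE; lra.
move: q3; rewrite ler_norml leadE => /andP[q3 _].
have h8 : C * `|ceta w| * S + `|K2| * (`|ceta w| * S) + `|ceta w| * S = D * (`|ceta w| * S).
  by rewrite /D; ring.
rewrite -/c0 in q1.
lra.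
Qed.

End EdgeCoercive.

(** * The discrete energy identity *)

Section EnergyIdentity.

Variables (N : nat) (s t : R).
Hypothesis s_gt0 : 0 < s.
Local Notation h := (mesh R N).
Local Notation x := (grid R N).
Local Notation e := (s * h).
Variables v u z : nat -> R.

Local Notation d := (diff_plus N v).

Definition sym_part j : R :=
  z j - acoef e t (x j) * discr_laplacian N v j + s ^+ 2 * mcoef e t (x j) * v j.
Definition antisym_part j : R :=
  s * (- 2 * phi_t t (x j) * u j + gcoef e t (x j) * (d j + d j.-1)).

(** Discrete form of s (2 phi_x v_t v_x - phi_t (v_t^2 + v_x^2)) - s^3 (phi_t^2 - phi_x^2) phi_t
    v^2. The part in v_x^2 lives on edges and makes up [edge_flux]. *)
Definition node_flux j : R :=
  s * (gcoef e t (x j) * u j * (d j + d j.-1) - phi_t t (x j) * u j ^+ 2)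
  - s ^+ 3 * (mcoef e t (x j) * phi_t t (x j)) * v j ^+ 2.
Definition edge_flux j : R :=
  - (s / 2 * (fcoef e t (x j) + fcoef e t (x j.+1)) * d j ^+ 2).

(** Formal derivative under v_t = u and u_t = z. At this stage [v], [u], [z] are unrelated
    sequences, and the identities below are pure algebra at one time. *)
Definition node_flux_t j : R :=
  s * ((gcoef_t e t (x j) * u j + gcoef e t (x j) * z j) * (d j + d j.-1)
    + gcoef e t (x j) * u j * (diff_plus N u j + diff_plus N u j.-1)
    - (phi_tt t (x j) * u j ^+ 2 + phi_t t (x j) * (2 * (u j * z j))))
  - s ^+ 3 * (zcoef_t e t (x j) * v j ^+ 2
    + mcoef e t (x j) * phi_t t (x j) * (2 * (v j * u j))).
Definition edge_flux_t j : R :=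
  - (s / 2 * ((fcoef_t e t (x j) + fcoef_t e t (x j.+1)) * d j ^+ 2
     + (fcoef e t (x j) + fcoef e t (x j.+1)) * (2 * (d j * diff_plus N u j)))).

(** The shares of a node in the edges on its two sides. Terms divided by h are not bounded one by
    one; the two ends of an edge carry them with opposite signs, so their sum is made of slopes of
    the coefficients and of the derivative of [edge_flux]. *)
Let left_half j : R :=
  s * (phi_tt t (x j) / 2 * u j ^+ 2 - gcoef_t e t (x j) * u j * d j
    - gcoef e t (x j) * u j * u j.+1 / h
    + 2 * fcoef e t (x j) * u j * d j / h
    - acoef e t (x j) * gcoef e t (x j) * d j ^+ 2 / h)
  + s ^+ 3 * (zcoef_t e t (x j) / 2 * v j ^+ 2
    + mcoef e t (x j) * gcoef e t (x j) * v j * v j.+1 / h).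
Let right_half i : R :=
  let j := i.+1 in
  s * (phi_tt t (x j) / 2 * u j ^+ 2 - gcoef_t e t (x j) * u j * d i
    + gcoef e t (x j) * u j * u i / h
    - 2 * fcoef e t (x j) * u j * d i / h
    + acoef e t (x j) * gcoef e t (x j) * d i ^+ 2 / h)
  + s ^+ 3 * (zcoef_t e t (x j) / 2 * v j ^+ 2
    - mcoef e t (x j) * gcoef e t (x j) * v j * v i / h).

Let h_neq0 : h != 0. Proof. by rewrite gt_eqF// mesh_gt0. Qed.

(** The flux is designed so that its derivative contains every product with [z]: neither half
    involves the second time derivative. *)
Lemma node_identity j : (0 < j)%N ->
  sym_part j * antisym_part j - node_flux_t j = left_half j + right_half j.-1.
Proof.
case: j => // j _.
rewrite /sym_part /antisym_part /node_flux_t /left_half /right_half /=.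
rewrite /discr_laplacian /diff_plus /= /fcoef /zcoef_t.
move: (phi_tt _ _) (gcoef_t _ _ _) (gcoef _ _ _) (acoef _ _ _) => r1 r2 r3 r4.
move: (mcoef_t _ _ _) (mcoef _ _ _) (phi_t _ _) => r5 r6 r7.
by move: (u j) (u j.+1) (u j.+2) (v j) (v j.+1) (v j.+2) (z j.+1) => *; field.
Qed.

Definition edge_cell j := Cell t (x j) h s.

Lemma edge_identity j :
  left_half j + right_half j = edge_flux_t j +
  s * edge_form (edge_cell j) (u j) (u j.+1) (d j) (s * v j) (s * v j.+1).
Proof.
rewrite /edge_form /edge_cell /slope /cy /ceta /= -gridS.
rewrite /left_half /right_half /edge_flux_t /diff_plus /=.
move: (phi_tt _ _) (phi_tt _ _) (gcoef_t _ _ _) (gcoef_t _ _ _) => r1 r2 r3 r4.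
move: (gcoef _ _ _) (gcoef _ _ _) (fcoef _ _ _) (fcoef _ _ _) => r5 r6 r7 r8.
move: (acoef _ _ _) (acoef _ _ _) (fcoef_t _ _ _) (fcoef_t _ _ _) => r9 r10 r11 r12.
move: (zcoef_t _ _ _) (zcoef_t _ _ _) (mcoef _ _ _) (mcoef _ _ _) => r13 r14 r15 r16.
by move: (u j) (u j.+1) (v j) (v j.+1) => *; field.
Qed.

(** At the end nodes u and v vanish and only d^2 survives. As phi_x > 0 there in the application,
    the term at x = 0 has the favourable sign; the one at x = 1 has the other and becomes the
    boundary observation. *)
Lemma energy_identity : v 0%N = 0 -> u 0%N = 0 -> v N.+1 = 0 -> u N.+1 = 0 ->
  \sum_(1 <= j < N.+1) sym_part j * antisym_part j =
  \sum_(1 <= j < N.+1) node_flux_t j + \sum_(0 <= j < N.+1) edge_flux_t j +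
  s * (\sum_(0 <= j < N.+1) edge_form (edge_cell j) (u j) (u j.+1)
     (d j) (s * v j) (s * v j.+1)
    + acoef e t 0 * gcoef e t 0 * d 0%N ^+ 2 / h
    - acoef e t 1 * gcoef e t 1 * d N ^+ 2 / h).
Proof.
move=> v0 u0 vN uN.
have := @big_node_edge R N left_half right_half.
under eq_big_nat => j /andP[j1 _] do rewrite -node_identity//.
under [X in _ = X - _ - _]eq_bigr do rewrite edge_identity.
rewrite sumrB [X in _ = X - _ - _]big_split/= -[X in _ = _ + X - _ - _]mulr_sumr => E.
have : left_half 0 = - (s * (acoef e t 0 * gcoef e t 0 * d 0%N ^+ 2 / h)).
  by rewrite /left_half grid0 u0 v0; ring.
have : right_half N = s * (acoef e t 1 * gcoef e t 1 * d N ^+ 2 / h).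
  by rewrite /right_half grid_last uN vN; ring.
have aux (A B X Y p q : R) : A - B = X + s * Y - (- (s * p)) - s * q ->
    A = B + X + s * (Y + p - q).
  by move=> /eqP; rewrite subr_eq => /eqP ->; ring.
by move=> R0 L0; apply: aux; rewrite E L0 R0.
Qed.

End EnergyIdentity.

(** * The estimate at a fixed time *)

Section StaticEstimate.

Local Notation h N := (mesh R N).
Local Notation x N := (grid R N).

Definition half_weight N (s t : R) (j : nat) : R := expR (s * ph t (x N j)).
Definition conj_fun N (s t : R) (w : nat -> R) j : R := half_weight N s t j * w j.
Definition conj_fun_t N (s t : R) (w wt : nat -> R) j : R :=
  half_weight N s t j * (wt j + s * phi_t t (x N j) * w j).
Definition conj_fun_tt N (s t : R) (w wt wtt : nat -> R) j : R :=
  half_weight N s t j * (wtt j + 2 * s * phi_t t (x N j) * wt j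
    + (s ^+ 2 * phi_t t (x N j) ^+ 2 + s * phi_tt t (x N j)) * w j).

Definition back_cell N (s t : R) j := Cell t (x N j) (- h N) s.

Lemma edge_cell_ok N s t j : `|t| <= T -> 1 <= s -> s * h N <= 1 -> (j <= N)%N ->
  cell_ok (edge_cell N s t j).
Proof.
move=> tT s1 sh jN; split => //=.
- by apply: grid_itv; rewrite leqW.
- by rewrite /cy /= -gridS; exact: grid_itv.
- by rewrite gt_eqF// mesh_gt0.
- split=> //; rewrite /ceta/= ger0_norm// mulr_ge0// ?ltW ?mesh_gt0//.
  exact: lt_le_trans s1.
Qed.

Lemma back_cell_ok N s t j : `|t| <= T -> 1 <= s -> s * h N <= 1 -> (0 < j <= N)%N ->
  cell_ok (back_cell N s t j).
Proof.
move=> tT s1 sh /andP[j0 jN]; split => //=.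
- by apply: grid_itv; rewrite leqW.
- rewrite /cy /=; case: j j0 jN => // j _ jN.
  by rewrite gridS addrK; apply: grid_itv; rewrite leqW// ltnW.
- by rewrite oppr_eq0 gt_eqF// mesh_gt0.
- split=> //; rewrite /ceta/= mulrN normrN ger0_norm// mulr_ge0// ?ltW ?mesh_gt0//.
  exact: lt_le_trans s1.
Qed.

Lemma half_weight_ratio N s t (a : R) i j :
  half_weight N s t i * a =
  expR (- (s * (ph t (x N j) - ph t (x N i)))) * (half_weight N s t j * a).
Proof. by rewrite mulrA -expRD; congr (expR _ * _); ring. Qed.

(* What remains of the conjugated operator besides its two main parts; it is
   of lower order in [s] because [phi] changes by [h phi_x + O(h ^+ 2)] along
   an edge. *)
Definition residual N s t q w wt wtt j : R :=
  half_weight N s t j *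
    (wtt j - discr_laplacian N w j + q j * w j)
  - sym_part N s t (conj_fun N s t w) (conj_fun_tt N s t w wt wtt) j
  - antisym_part N s t (conj_fun N s t w) (conj_fun_t N s t w wt) j.

(** cosh p and sinh p recombine into e^(-p) and e^p, so that all time derivatives of w cancel. There
    remain q, phi_tt and the errors of linearising phi along the two adjacent edges, all acting on V
    = s v with bounded coefficients. *)
Lemma residualE N s t q w wt wtt j : 1 <= s -> (0 < j)%N ->
  let V j := s * conj_fun N s t w j in
  residual N s t q w wt wtt j =
  (q j / s - phi_tt t (x N j)) * V j
  + (expR (- (s * h N * phi_x t (x N j)))
      - weight_ratio (edge_cell N s t j)) / (s * h N ^+ 2) * V j.+1
  + (expR (- (s * - h N * phi_x t (x N j)))
      - weight_ratio (back_cell N s t j)) / (s * h N ^+ 2) * V j.-1.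
Proof.
case: j => // j s1 _ /=.
have hn0 : h N != 0 by rewrite gt_eqF// mesh_gt0.
have sn0 : s != 0 by rewrite gt_eqF// (lt_le_trans ltr01).
have E1 : half_weight N s t j.+1 * w j.+2 =
  expR (- (s * (ph t (x N j.+2) - ph t (x N j.+1)))) * conj_fun N s t w j.+2.
  exact: half_weight_ratio.
have E2 : half_weight N s t j.+1 * w j =
  expR (- (s * (ph t (x N j) - ph t (x N j.+1)))) * conj_fun N s t w j.
  exact: half_weight_ratio.
have xj : x N j.+1 - h N = x N j by rewrite gridS addrK.
rewrite /weight_ratio /back_cell /edge_cell /cy /= -gridS xj.
move: E1 E2.
move: (expR (- (s * (ph t (x N j.+2) - _)))) (expR (- (s * (ph t (x N j) - _)))) => r1 r2 E1 E2.
rewrite /residual /sym_part /antisym_part /acoef /gcoef /mcoef /kcoef.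
have -> : - (s * - h N * phi_x t (x N j.+1)) = s * h N * phi_x t (x N j.+1) by ring.
rewrite /coshR /sinhR.
rewrite /discr_laplacian /diff_plus /=.
have -> : half_weight N s t j.+1 * (wtt j.+1 - (w j.+2 - 2 * w j.+1 + w j) / h N ^+ 2 +
   q j.+1 * w j.+1) = half_weight N s t j.+1 * wtt j.+1
   - (half_weight N s t j.+1 * w j.+2 - 2 * (half_weight N s t j.+1 * w j.+1)
     + half_weight N s t j.+1 * w j) / h N ^+ 2 + q j.+1 * (half_weight N s t j.+1 * w j.+1).
  by ring.
rewrite E1 E2 /conj_fun_t /conj_fun_tt.
rewrite [conj_fun N s t w j.+1]/conj_fun.
by field; rewrite hn0 sn0.
Qed.

Lemma residual_bound m : 0 <= m -> exists C, 0 <= C /\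
  forall N s t q w wt wtt j, `|t| <= T -> 1 <= s -> s * h N <= 1 ->
  discr_Linfty_le N m q -> (0 < j <= N)%N ->
  let V j := s * conj_fun N s t w j in
  residual N s t q w wt wtt j ^+ 2 <=
  C * (V j ^+ 2 + V j.+1 ^+ 2 + V j.-1 ^+ 2).
Proof.
move=> m0.
have [K1 HK1] := bounded_phi_tt.
have [K2 HK2] := weight_ratio_taylor.
pose A := m + `|K1| + `|K2|.
exists (3 * A ^+ 2); split; first by rewrite mulr_ge0// sqr_ge0.
move=> N s t q w wt wtt j tT s1 sh qm jN /=; pose V i := s * conj_fun N s t w i.
have /andP[j0 jN'] := jN.
have c1 := edge_cell_ok tT s1 sh jN'.
have c2 := back_cell_ok tT s1 sh jN.
have s0 : 0 < s by exact: lt_le_trans s1.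
rewrite residualE//= -/(V j) -/(V j.+1) -/(V j.-1).
apply: sqr_lincomb3_le.
- apply: le_trans (ler_normB _ _) _; rewrite /A -addrA lerD//.
    rewrite normrM normfV (gtr0_norm s0) ler_pdivrMr//.
    by apply: le_trans (qm j jN) _; rewrite ler_peMr.
  have k1 : `|phi_tt t (x N j)| <= `|K1| := le_trans (HK1 _ c1) (ler_norm _).
  by apply: le_trans k1 _; rewrite lerDl.
- rewrite -normrN -mulNr opprB.
  apply: le_trans (le_trans (HK2 _ c1) (ler_norm _)) _.
  by rewrite /A lerDr addr_ge0.
- rewrite -normrN -mulNr opprB; have := le_trans (HK2 _ c2) (ler_norm _).
  rewrite /ceta /= sqrrN => H; apply: le_trans H _.
  by rewrite /A lerDr addr_ge0.
Qed.

Lemma weighted_time_derivative_bound : exists C, 0 <= C /\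
  forall N s t w wt j, `|t| <= T -> 1 <= s -> s * h N <= 1 -> (j <= N)%N ->
  (half_weight N s t j * wt j) ^+ 2 <=
  C * (conj_fun_t N s t w wt j ^+ 2 + (s * conj_fun N s t w j) ^+ 2).
Proof.
have [K HK] := bounded_phi_t.
exists (3 * (1 + `|K|) ^+ 2); split; first by rewrite mulr_ge0// sqr_ge0.
move=> N s t w wt j tT s1 sh jN.
have c1 := le_trans (HK _ (edge_cell_ok tT s1 sh jN)) (ler_norm _).
have -> : half_weight N s t j * wt j = 1 * conj_fun_t N s t w wt j
    + - phi_t t (x N j) * (s * conj_fun N s t w j) + 0 * 0.
  by rewrite /conj_fun_t /conj_fun; ring.
rewrite -[X in _ <= _ * X]addr0 -[X in _ <= _ * (_ + X)](expr0n _ 2).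
apply: sqr_lincomb3_le.
- by rewrite normr1 lerDl.
- by rewrite normrN (le_trans c1)// lerDr.
- by rewrite normr0 addr_ge0.
Qed.

Lemma weighted_diff_bound : exists C, 0 <= C /\
  forall N s t w j, `|t| <= T -> 1 <= s -> s * h N <= 1 -> (j <= N)%N ->
  (half_weight N s t j * diff_plus N w j) ^+ 2 <=
  C * (diff_plus N (conj_fun N s t w) j ^+ 2 + (s * conj_fun N s t w j.+1) ^+ 2).
Proof.
have [K HK] := weight_ratio_sub1.
exists (3 * (1 + `|K|) ^+ 2); split; first by rewrite mulr_ge0// sqr_ge0.
move=> N s t w j tT s1 sh jN.
have c1 := le_trans (HK _ (edge_cell_ok tT s1 sh jN)) (ler_norm _).
have hn0 : h N != 0 by rewrite gt_eqF// mesh_gt0.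
have sn0 : s != 0 by rewrite gt_eqF// (lt_le_trans ltr01).
set r := (weight_ratio (edge_cell N s t j) - 1) / _ in c1.
have -> : half_weight N s t j * diff_plus N w j =
   1 * diff_plus N (conj_fun N s t w) j + r * (s * conj_fun N s t w j.+1) + 0 * 0.
  have E := half_weight_ratio N s t (w j.+1) j j.+1.
  rewrite /r /weight_ratio /edge_cell /cy /ceta /= -gridS.
  rewrite /diff_plus mulrA mulrBr E /conj_fun.
  move: (expR _) (half_weight N s t j.+1) (half_weight N s t j) => *.
  by field; rewrite hn0 sn0.
rewrite -[X in _ <= _ * X]addr0 -[X in _ <= _ * (_ + X)](expr0n _ 2).
apply: sqr_lincomb3_le.
- by rewrite normr1 lerDl.
- by rewrite (le_trans c1)// lerDr.
- by rewrite normr0 addr_ge0.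
Qed.

(** Source of the last term of the estimate. Moving e^(s phi) across an edge costs a factor s h, so
    the jump of v_t is the weighted jump of w_t plus s h times quantities that the edge form
    controls; these are reabsorbed when s h is small. *)
Lemma conj_fun_t_increment_bound : exists C, 0 <= C /\
  forall N s t w wt j, `|t| <= T -> 1 <= s -> s * h N <= 1 -> (j <= N)%N ->
  (conj_fun_t N s t w wt j.+1 - conj_fun_t N s t w wt j) ^+ 2 <=
  2 * (half_weight N s t j * (h N * diff_plus N wt j)) ^+ 2 +
  C * (s * h N) * (conj_fun_t N s t w wt j.+1 ^+ 2 + (s * conj_fun N s t w j.+1) ^+ 2
    + diff_plus N (conj_fun N s t w) j ^+ 2).
Proof.
have [K1 HK1] := weight_ratio_sub1.
have [K2 HK2] := phi_t_shift.
have [K3 HK3] := bounded_phi_t.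
have [K4 HK4] := approx_bounded_on ceta_le1 (bounded_phi_t) (phi_t_shift).
pose A := `|K1| + `|K2| + `|K3| + `|K1| * `|K4|.
have A0 : 0 <= A by rewrite !addr_ge0// mulr_ge0.
exists (6 * A ^+ 2); split; first by rewrite mulr_ge0// sqr_ge0.
move=> N s t w wt j tT s1 sh jN.
have cok := edge_cell_ok tT s1 sh jN.
have hp := @mesh_gt0 R N.
have sp : 0 < s by exact: lt_le_trans s1.
have hn0 : h N != 0 by rewrite gt_eqF.
have sn0 : s != 0 by rewrite gt_eqF.
have c1 := le_trans (HK1 _ cok) (ler_norm _).
have c2 := HK2 _ cok.
have c3 := le_trans (HK3 _ cok) (ler_norm _).
have c4 := le_trans (HK4 _ cok) (ler_norm _).
set r := weight_ratio (edge_cell N s t j) in c1.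
set e := s * h N.
have ep : 0 < e by rewrite mulr_gt0.
have eE : ceta (edge_cell N s t j) = e by [].
rewrite eE in c1 c2; rewrite /cy /= -gridS in c2 c4.
rewrite (gtr0_norm ep) in c2.
set D := half_weight N s t j * _.
set u := conj_fun_t N s t w wt j; set u' := conj_fun_t N s t w wt j.+1.
set V' := s * conj_fun N s t w j.+1; set d := diff_plus N _ j.
pose a1 := - ((r - 1) / e).
pose a2 := (r - 1) / e * phi_t t (x N j.+1) + (phi_t t (x N j.+1) - phi_t t (x N j)) / e.
pose a3 := phi_t t (x N j).
have E : u' - u = D + e * (a1 * u' + a2 * V' + a3 * d).
  have E2 := half_weight_ratio N s t (wt j.+1) j j.+1.
  have rE : r = expR (- (s * (ph t (x N j.+1) - ph t (x N j)))).
    by rewrite /r /weight_ratio /edge_cell /cy /= -gridS.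
  rewrite -rE in E2.
  have DE : D = half_weight N s t j * wt j.+1 - half_weight N s t j * wt j.
    by rewrite /D /diff_plus [h N * _]mulrC divfK// mulrBr.
  rewrite DE E2 /u /u' /V' /d /a1 /a2 /a3 /diff_plus /e /conj_fun_t /conj_fun.
  move: (half_weight N s t j.+1) (half_weight N s t j).
  move: (phi_t t (x N j.+1)) (phi_t t (x N j)) (w j.+1) (w j) (wt j.+1) (wt j) => *.
  by field; rewrite hn0 sn0.
have b1 : `|a1| <= A by rewrite normrN (le_trans c1)// /A -!addrA lerDl !addr_ge0// mulr_ge0.
have b2 : `|a2| <= A.
  apply: le_trans (ler_normD _ _) _.
  have q1 : `|(r - 1) / e * phi_t t (x N j.+1)| <= `|K1| * `|K4|.
    by rewrite normrM ler_pM.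
  have q2 : `|(phi_t t (x N j.+1) - phi_t t (x N j)) / e| <= `|K2|.
    rewrite normrM normfV (gtr0_norm ep) ler_pdivrMr//; apply: le_trans c2 _.
    by apply: ler_wpM2r; [exact: ltW|exact: ler_norm].
  apply: le_trans (lerD q1 q2) _.
  rewrite /A; have := normr_ge0 K1; have := normr_ge0 K3; move: (`|K1| * _) => k14; lra.
have b3 : `|a3| <= A.
  apply: le_trans c3 _; rewrite /A addrAC lerDr !addr_ge0// mulr_ge0//.
have L := sqr_lincomb3_le u' V' d b1 b2 b3.
set Q := a1 * u' + a2 * V' + a3 * d in E L *.
have S0 : 0 <= u' ^+ 2 + V' ^+ 2 + d ^+ 2 by rewrite !addr_ge0 ?sqr_ge0.
have ee : e ^+ 2 * Q ^+ 2 <= e * (3 * A ^+ 2 * (u' ^+ 2 + V' ^+ 2 + d ^+ 2)).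
  rewrite ler_pM ?sqr_ge0// expr2 ler_piMr// ltW//.
rewrite E.
have := sqr_ge0 (D - e * Q).
have -> : (D - e * Q) ^+ 2 = 2 * D ^+ 2 + 2 * (e ^+ 2 * Q ^+ 2) - (D + e * Q) ^+ 2 by ring.
have -> : 6 * A ^+ 2 * e * (u' ^+ 2 + V' ^+ 2 + d ^+ 2) =
  2 * (e * (3 * A ^+ 2 * (u' ^+ 2 + V' ^+ 2 + d ^+ 2))) by ring.
move: ee; clear; lra.
Qed.

Lemma phi_x_ge0 t y : 0 < lam -> x0 < 0 -> 0 <= y -> 0 <= phi_x t y.
Proof.
move=> lam_gt0 x0_lt0 y0; rewrite /phi_x mulr_ge0 ?expR_ge0// /xfac !mulr_ge0//; first exact: ltW.
by rewrite subr_ge0; apply: le_trans y0; exact: ltW.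
Qed.

Lemma agcoef_ge0 (e t y : R) : 0 < lam -> x0 < 0 -> 0 < e -> 0 <= y -> 0 <= acoef e t y * gcoef e t y.
Proof.
move=> lam_gt0 x0_lt0 e0 y0; have p0 := phi_x_ge0 t lam_gt0 x0_lt0 y0; rewrite mulr_ge0//.
  by rewrite /acoef /coshR divr_ge0// addr_ge0// expR_ge0.
rewrite /gcoef /sinhR !divr_ge0// ?(ltW e0)// subr_ge0 ler_expR.
by have := mulr_ge0 (ltW e0) p0; lra.
Qed.

(** As x0 < 0, the weight increases with x; this lets the boundary term be written with the weight
    at 1. *)
Lemma phi_grid_le N t : 0 < lam -> x0 < 0 -> ph t (x N N) <= ph t (x N N.+1).
Proof.
move=> lam_gt0 x0_lt0; rewrite /phi ler_expR; apply: ler_wpM2l; first exact: ltW.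
rewrite /psi lerD2r lerD2r.
have := grid_itv R (leqnSn N); have hp := @mesh_gt0 R N; rewrite gridS => /andP[g0 _].
by rewrite !ger0_norm ?lerXn2r ?nnegrE//; lra.
Qed.

Definition total_flux_t N s t w wt wtt : R :=
  let v := conj_fun N s t w in let u := conj_fun_t N s t w wt in
  let z := conj_fun_tt N s t w wt wtt in
  h N * (\sum_(1 <= j < N.+1) node_flux_t N s t v u z j
    + \sum_(0 <= j < N.+1) edge_flux_t N s t v u j).

(** Balance of the coercivity c: half of it pays for the O(s h) part of the jump of v_t, a quarter
    for the residual, and s c / 4 times the sum over edges dominates the left side. *)
Lemma static_estimate m : 0 < lam -> 0 < beta -> beta < 1 -> x0 < 0 ->
  1 <= lam * (1 - beta) * x0 ^+ 2 ->
  (forall w, cell_ok w -> 1 <= ph (ct w) (cx w)) -> 0 <= m -> exists s0 eps M M',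
  [/\ 0 < s0, 0 < eps, 0 < M & 0 < M'] /\
  forall N s t q w wt wtt, `|t| <= T -> s0 < s -> s * h N < eps ->
  discr_Linfty_le N m q ->
  w 0%N = 0 -> w N.+1 = 0 -> wt 0%N = 0 -> wt N.+1 = 0 ->
  s * int_oo N (fun j => (half_weight N s t j * wt j) ^+ 2)
  + s * int_co N (fun j => (half_weight N s t j * diff_plus N w j) ^+ 2)
  + s ^+ 3 * int_oo N (fun j => (half_weight N s t j * w j) ^+ 2)
  <= M * int_oo N (fun j => (half_weight N s t j *
       (wtt j - discr_laplacian N w j + q j * w j)) ^+ 2)
   + M * s * (half_weight N s t N.+1 * diff_minus N w N.+1) ^+ 2
   + M * s * int_co N (fun j => (half_weight N s t j * (h N * diff_plus N wt j)) ^+ 2)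
   - M' * total_flux_t N s t w wt wtt.
Proof.
move=> lam_gt0 beta_gt0 beta_lt1 x0_lt0 lam_ge phi_ge1 m0.
have [c [eps1 [K [[c0 eps10 eps11 K0] HE]]]] :=
  edge_coercive lam_gt0 beta_gt0 beta_lt1 x0_lt0 lam_ge phi_ge1.
have [C1 [C10 HR]] := residual_bound m0.
have [C2 [C20 HT]] := weighted_time_derivative_bound.
have [C3 [C30 HX]] := weighted_diff_bound.
have [C4 [C40 HU]] := conj_fun_t_increment_bound.
have [C5 HB] := bounded_agcoef_shift.
pose KC := K * C4 + 1.
have KC0 : 0 < KC by rewrite /KC; have := mulr_ge0 K0 C40; lra.
pose C6 := C2 + C3 + 1.
have C60 : 0 < C6 by rewrite /C6; lra.
pose mu := 4 * C6 / c.
have mu0 : 0 < mu by rewrite /mu divr_gt0// mulr_gt0.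
pose D := 1 + 2 * K + `|C5|.
have C5n := normr_ge0 C5.
have D0 : 0 < D by rewrite /D; lra.
have DK : [/\ 2^-1 <= D, 2 * K <= D & `|C5| <= D] by rewrite /D; split; lra.
have KCge : K * C4 <= KC by rewrite /KC lerDl.
(* [s0] yields C1 <= s c / 4 for the residual and [eps] yields K C4 s h <= c / 2 for the jump of
   v_t. The factor [mu] turns c / 4 into [C6], the cost of returning from v to w, and [D] dominates
   the three constants on the right. *)
exists (1 + 4 * C1 / c), (Num.min eps1 (c / 2 / KC)), (mu * D), mu; split.
  split => //; last exact: mulr_gt0.
  - have : 0 <= 4 * C1 / c by rewrite divr_ge0 ?(ltW c0)// mulr_ge0.
    by move=> ?; lra.
  - by rewrite lt_min eps10/= !divr_gt0.
move=> N s t q w wt wtt tT s0s; rewrite lt_min => /andP[she1 she2] qm w0 wN wt0 wtN.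
have s1 : 1 <= s.
  by apply: le_trans _ (ltW s0s); rewrite lerDl divr_ge0 ?(ltW c0)// mulr_ge0.
have sp : 0 < s by exact: lt_le_trans s1.
have hp := @mesh_gt0 R N.
set e := s * h N in she1 she2.
have ep : 0 < e by rewrite mulr_gt0.
have sh1 : e <= 1 by apply: le_trans (ltW she1) eps11.
have cok j : (j <= N)%N -> cell_ok (edge_cell N s t j) by exact: edge_cell_ok.
pose v := conj_fun N s t w; pose u := conj_fun_t N s t w wt.
pose z := conj_fun_tt N s t w wt wtt.
pose V j := s * v j.
pose d j := diff_plus N v j.
pose S j := u j ^+ 2 + u j.+1 ^+ 2 + d j ^+ 2 + V j ^+ 2 + V j.+1 ^+ 2.
have S0 j : 0 <= S j by rewrite !addr_ge0 ?sqr_ge0.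
pose SS := \sum_(0 <= j < N.+1) S j.
have SS0 : 0 <= SS by rewrite sumr_ge0.
have Sge j : [/\ u j ^+ 2 + V j ^+ 2 <= S j, d j ^+ 2 + V j.+1 ^+ 2 <= S j,
    V j ^+ 2 + V j.+1 ^+ 2 <= S j, V j ^+ 2 <= S j &
    u j.+1 ^+ 2 + V j.+1 ^+ 2 + d j ^+ 2 <= S j].
  have := sqr_ge0 (u j); have := sqr_ge0 (u j.+1); have := sqr_ge0 (d j).
  have := sqr_ge0 (V j); have := sqr_ge0 (V j.+1); rewrite /S.
  move: (u j ^+ 2) (u j.+1 ^+ 2) (d j ^+ 2) (V j ^+ 2) (V j.+1 ^+ 2) => a1 a2 a3 a4 a5.
  by clear; move=> *; split; lra.
have v0 : v 0%N = 0 by rewrite /v /conj_fun w0 mulr0.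
have vN : v N.+1 = 0 by rewrite /v /conj_fun wN mulr0.
have u0 : u 0%N = 0 by rewrite /u /conj_fun_t w0 wt0 mulr0 addr0 mulr0.
have uN : u N.+1 = 0 by rewrite /u /conj_fun_t wN wtN mulr0 addr0 mulr0.
have EI := energy_identity s t z v0 u0 vN uN.
pose Pw j := half_weight N s t j * (wtt j - discr_laplacian N w j + q j * w j).
pose PW := \sum_(1 <= j < N.+1) Pw j ^+ 2.
pose Dt j := half_weight N s t j * (h N * diff_plus N wt j).
pose DD := \sum_(0 <= j < N.+1) Dt j ^+ 2.
pose Rs := residual N s t q w wt wtt.
have I1 : \sum_(1 <= j < N.+1) sym_part N s t v z j *
    antisym_part N s t v u j <= PW / 2 + C1 * SS.
  apply: (@le_trans _ _ (\sum_(1 <= j < N.+1) (Pw j ^+ 2 / 2 + Rs j ^+ 2 / 2))).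
    apply: ler_sum_nat => j _.
    have -> : Pw j = sym_part N s t v z j +
      antisym_part N s t v u j + Rs j.
      by rewrite /Rs /residual -/v -/u -/z /Pw; ring.
    exact: mul_le_sqr_halves.
  rewrite big_split/= -!mulr_suml lerD2l.
  have : \sum_(1 <= j < N.+1) Rs j ^+ 2 <= C1 * (SS + SS).
    apply: (@le_trans _ _ (\sum_(1 <= j < N.+1) C1 *
        ((V j ^+ 2 + V j.+1 ^+ 2) + V j.-1 ^+ 2))).
      by apply: ler_sum_nat => j jN; exact: HR.
    rewrite -mulr_sumr ler_wpM2l// big_split/= lerD//.
      by apply: sum_node_le_edge => // j _; have [] := Sge j.
    apply: (sum_node_pred_le_edge (F := fun j => V j ^+ 2)) => // j _.
    by have [] := Sge j.
  by clear; move=> *; lra.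
have I2 : c / 2 * SS - 2 * K * DD <= \sum_(0 <= j < N.+1)
   edge_form (edge_cell N s t j) (u j) (u j.+1) (d j) (V j) (V j.+1).
  rewrite /SS /DD !mulr_sumr -sumrB; apply: ler_sum_nat => j /andP[_ jN].
  have VV : V j.+1 - V j = ceta (edge_cell N s t j) * d j.
    rewrite /V /d /diff_plus /ceta /=; field.
    by rewrite gt_eqF.
  have eabs : `|ceta (edge_cell N s t j)| <= eps1.
    by rewrite /ceta/= -/e gtr0_norm// ltW.
  have := HE _ (cok j jN) eabs (u j) (u j.+1) (d j) (V j) (V j.+1) VV.
  apply: le_trans; rewrite -/(S j).
  have := HU N s t w wt j tT s1 sh1 jN.
  rewrite -/(Dt j) -/u -/v -/(V j.+1) -/(d j) -/e => HUj.
  have [_ _ _ _ S5] := Sge j.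
  have q1 : (u j.+1 - u j) ^+ 2 <= 2 * Dt j ^+ 2 + C4 * e * S j.
    by apply: le_trans HUj _; rewrite lerD2l ler_wpM2l// mulr_ge0// ltW.
  have q2 := ler_wpM2l K0 q1.
  have q3 : K * C4 * e * S j <= c / 2 * S j.
    rewrite ler_wpM2r//; apply: (@le_trans _ _ (KC * e)).
      by apply: ler_wpM2r; first exact: ltW.
    by rewrite mulrC -ler_pdivlMr// ltW.
  rewrite mulrDr in q2.
  have q4 : K * (C4 * e * S j) = K * C4 * e * S j by ring.
  have q5 : K * (2 * Dt j ^+ 2) = 2 * K * Dt j ^+ 2 by ring.
  move: q2 q3; rewrite q4 q5.
  move: ((u j.+1 - u j) ^+ 2) (Dt j ^+ 2) (S j) => a1 a2 a4; clear.
  by move=> *; lra.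
pose B := (half_weight N s t N.+1 * diff_minus N w N.+1) ^+ 2.
have B0 : 0 <= B by exact: sqr_ge0.
(* The point 1 is the right end of the last cell, hence the bound at shifted points. Since v
   vanishes at N + 1, [d N] carries the weight of node N, which is at most the weight at 1. *)
have I3 : acoef e t 1 * gcoef e t 1 * d N ^+ 2 / h N <= `|C5| * B / h N.
  apply: ler_wpM2r; first by rewrite invr_ge0 ltW.
  have dB : d N ^+ 2 <= B.
    have -> : d N = - (half_weight N s t N * (w N / h N)).
      by rewrite /d /diff_plus vN /v /conj_fun; ring.
    have -> : B = (half_weight N s t N.+1 * (w N / h N)) ^+ 2.
      by rewrite /B /diff_minus wN /=; ring.
    rewrite sqrrN !exprMn; apply: ler_wpM2r; first exact: mulr_ge0 (sqr_ge0 _) (sqr_ge0 _).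
    rewrite lerXn2r ?nnegrE ?expR_ge0// /half_weight ler_expR.
    by apply: ler_wpM2l; [exact: ltW|exact: phi_grid_le].
  apply: ler_pM => //; [exact: agcoef_ge0|exact: sqr_ge0|].
  have := HB _ (cok N (leqnn N)).
  rewrite /ceta /cy /= -gridS grid_last -/e => H.
  by apply: le_trans (ler_norm _) _; apply: le_trans H (ler_norm _).
have I4 : 0 <= acoef e t 0 * gcoef e t 0 * d 0%N ^+ 2 / h N.
  by rewrite divr_ge0 ?(ltW hp)// mulr_ge0 ?sqr_ge0// agcoef_ge0.
pose F := total_flux_t N s t w wt wtt.
have I5 : s * c / 4 * SS <= PW / 2 + 2 * K * s * DD + s * (`|C5| * B / h N) - F / h N.
  have FE : F / h N = \sum_(1 <= j < N.+1) node_flux_t N s t v u z j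
    + \sum_(0 <= j < N.+1) edge_flux_t N s t v u j.
    by rewrite /F /total_flux_t mulrAC mulfV ?mul1r// gt_eqF.
  move: I1; rewrite EI -FE => I1.
  have sc : C1 * SS <= s * c / 4 * SS.
    rewrite ler_wpM2r// ler_pdivlMr// mulrC -ler_pdivrMr//.
    by apply: ltW; apply: le_lt_trans s0s; rewrite lerDr.
  have q7 : s * (c / 2 * SS - 2 * K * DD - `|C5| * B / h N) <= PW / 2 + C1 * SS - F / h N.
    apply: (@le_trans _ _ (s * (\sum_(0 <= j < N.+1)
     edge_form (edge_cell N s t j) (u j) (u j.+1) (d j) (V j) (V j.+1)
       + acoef e t 0 * gcoef e t 0 * d 0%N ^+ 2 / h N
       - acoef e t 1 * gcoef e t 1 * d N ^+ 2 / h N))).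
      rewrite ler_wpM2l ?(ltW sp)//.
      by apply: le_trans (lerB I2 I3) _; rewrite lerD2r lerDl.
    by rewrite lerBrDl; exact: I1.
  have -> : 2 * K * s * DD = s * (2 * K * DD) by ring.
  have q6 : s * c / 4 * SS + s * c / 4 * SS = s * (c / 2 * SS) by field.
  move: q7; rewrite !mulrBr -q6; move: sc; clear; move=> *; lra.
pose LH := s * (\sum_(1 <= j < N.+1) (half_weight N s t j * wt j) ^+ 2
  + \sum_(0 <= j < N.+1) (half_weight N s t j * diff_plus N w j) ^+ 2
  + \sum_(1 <= j < N.+1) V j ^+ 2).
have I6 : LH <= s * (C6 * SS).
  rewrite /LH ler_wpM2l ?(ltW sp)//.
  have -> : C6 * SS = C2 * SS + C3 * SS + SS by rewrite /C6; ring.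
  rewrite /SS !mulr_sumr; apply: lerD; first apply: lerD.
  - apply: sum_node_le_edge => [j jN|]; last by rewrite mulr_ge0.
    apply: le_trans (HT N s t w wt j tT s1 sh1 jN) _; rewrite ler_wpM2l//.
    by have [] := Sge j.
  - apply: ler_sum_nat => j /andP[_ jN].
    apply: le_trans (HX N s t w j tT s1 sh1 jN) _; rewrite ler_wpM2l//.
    by have [] := Sge j.
  - by apply: sum_node_le_edge => // j _; have [] := Sge j.
have I7 : s * (C6 * SS) = mu * (s * c / 4 * SS).
  by rewrite /mu; field; rewrite gt_eqF.
have I8 := ler_wpM2l (ltW mu0) I5; rewrite -I7 in I8.
have I9 := le_trans I6 I8.
rewrite /int_oo /int_co -/PW -/DD -/B -/F.
have -> : s * (h N * \sum_(1 <= j < N.+1) (half_weight N s t j * wt j) ^+ 2) +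
  s * (h N * \sum_(0 <= j < N.+1) (half_weight N s t j * diff_plus N w j) ^+ 2) +
  s ^+ 3 * (h N * \sum_(1 <= j < N.+1) (half_weight N s t j * w j) ^+ 2) = h N * LH.
  rewrite /LH.
  have -> : \sum_(1 <= j < N.+1) V j ^+ 2 =
    s ^+ 2 * \sum_(1 <= j < N.+1) (half_weight N s t j * w j) ^+ 2.
    by rewrite mulr_sumr; apply: eq_bigr => j _; rewrite /V /v /conj_fun exprMn.
  by ring.
apply: le_trans (ler_wpM2l (ltW hp) I9) _.
have PW0 : 0 <= PW by rewrite sumr_ge0// => j _; exact: sqr_ge0.
have DD0 : 0 <= DD by rewrite sumr_ge0// => j _; exact: sqr_ge0.
have -> : h N * (mu * (PW / 2 + 2 * K * s * DD + s * (`|C5| * B / h N) - F / h N)) =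
  mu * (h N * PW) / 2 + mu * (2 * K) * (s * (h N * DD)) + mu * `|C5| * (s * B) - mu * F.
  by field; rewrite gt_eqF.
rewrite lerD2r.
have -> : mu * D * (h N * PW) + mu * D * s * B + mu * D * s * (h N * DD) =
  mu * D * (h N * PW) + mu * D * (s * (h N * DD)) + mu * D * (s * B) by ring.
have muD k : 0 <= k -> k <= D -> forall y, 0 <= y -> mu * k * y <= mu * D * y.
  by move=> k0 kD y y0; rewrite ler_wpM2r// ler_wpM2l// ltW.
have [D1 D2 D3] := DK.
apply: lerD; first apply: lerD.
- rewrite mulrAC; apply: muD => //; exact: mulr_ge0 (ltW hp) PW0.
- apply: muD => //; first exact: mulr_ge0.
  exact: mulr_ge0 (ltW sp) (mulr_ge0 (ltW hp) DD0).
- by apply: muD => //; exact: mulr_ge0 (ltW sp) B0.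
Qed.

End StaticEstimate.

(** * Integration in time *)

Section FluxDerivative.

Lemma C1_tfac : C1_derivative (fun t => tfac t) (fun=> - (2 * lam * beta)).
Proof.
apply: eq_C1 (C1_M (C1_cst (- (2 * lam * beta))) (C1_id R)) => t; rewrite /tfac; ring.
Qed.

Lemma C1_phi y : C1_derivative (fun t => ph t y) (fun t => phi_t t y).
Proof.
have h : C1_derivative (fun t => lam * (`|y - x0| ^+ 2 + C0) + - (lam * beta) * (t * t))
   (fun t => 0 + (0 * (t * t) + - (lam * beta) * (1 * t + t * 1))).
  by have i := C1_id R; C1_solve.
apply: eq_C1 (C1_expR h) => t; rewrite /phi_t /phi /psi /tfac.
  by congr expR; ring.
by congr (_ * _); [ring|congr expR; ring].
Qed.

Lemma C1_phi_t y : C1_derivative (fun t => phi_t t y) (fun t => phi_tt t y).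
Proof.
apply: eq_C1 (C1_M C1_tfac (C1_phi y)) => t //.
by rewrite /phi_tt /phi_t; ring.
Qed.

Lemma C1_phi_x y : C1_derivative (fun t => phi_x t y) (fun t => phi_tx t y).
Proof.
apply: eq_C1 (C1_M (C1_cst (xfac y)) (C1_phi y)) => t //.
by rewrite /phi_tx /phi_t; ring.
Qed.

Lemma C1_expR_phi_x e y : C1_derivative (fun t => expR (e * phi_x t y))
  (fun t => (0 * phi_x t y + e * phi_tx t y) * expR (e * phi_x t y)).
Proof. by have := C1_phi_x y => ?; C1_solve. Qed.

Lemma C1_acoef e y : C1_derivative (fun t => acoef e t y) (fun t => acoef_t e t y).
Proof.
have h1 := C1_expR_phi_x e y; have h2 := C1_expR_phi_x (- e) y.
apply: eq_C1 (C1_M (C1_D h1 h2) (C1_cst (2^-1))) => t; rewrite /acoef /acoef_t /coshR /sinhR.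
  by rewrite -mulNr.
by rewrite -mulNr; ring.
Qed.

Lemma C1_gcoef e y : e != 0 -> C1_derivative (fun t => gcoef e t y) (fun t => gcoef_t e t y).
Proof.
move=> e0; have h1 := C1_expR_phi_x e y; have h2 := C1_expR_phi_x (- e) y.
have h3 := C1_M (C1_cst (-1)) h2.
apply: eq_C1 (C1_M (C1_D h1 h3) (C1_cst ((2 * e)^-1))) => t; rewrite /gcoef /gcoef_t /coshR /sinhR.
  by rewrite -mulNr; field.
by rewrite -mulNr; field.
Qed.

Lemma C1_mcoef e y : e != 0 -> C1_derivative (fun t => mcoef e t y) (fun t => mcoef_t e t y).
Proof.
move=> e0; have h1 := C1_acoef e y; have h2 := C1_phi_t y.
apply: eq_C1 (C1_D (C1_M h2 h2) (C1_M (C1_D h1 (C1_cst (-1))) (C1_cst (- (2 / e ^+ 2))))) => t.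
  by rewrite /mcoef /kcoef /acoef; ring.
by rewrite /mcoef_t /kcoef_t /gcoef /acoef_t /acoef; field.
Qed.

Lemma C1_fcoef e y : C1_derivative (fun t => fcoef e t y) (fun t => fcoef_t e t y).
Proof. by apply: eq_C1 (C1_M (C1_acoef e y) (C1_phi_t y)) => t. Qed.

Lemma C1_mphi_t e y : e != 0 ->
  C1_derivative (fun t => mcoef e t y * phi_t t y) (fun t => zcoef_t e t y).
Proof. by move=> e0; apply: eq_C1 (C1_M (C1_mcoef y e0) (C1_phi_t y)) => t. Qed.

Variables (T_gt0 : 0 < T) (N : nat) (s : R) (s_gt0 : 0 < s).
Local Notation td := (time_derivative T).
Local Notation h := (mesh R N).
Local Notation x := (grid R N).
Local Notation e := (s * h).
Variables w wt wtt : nat -> R -> R.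
Hypothesis w_wt : forall j, (j <= N.+1)%N -> td (w j) (wt j) /\ td (wt j) (wtt j).

Let v j t := conj_fun N s t (fun i => w i t) j.
Let u j t := conj_fun_t N s t (fun i => w i t) (fun i => wt i t) j.
Let z j t := conj_fun_tt N s t (fun i => w i t) (fun i => wt i t) (fun i => wtt i t) j.

Let e_neq0 : e != 0. Proof. by rewrite mulf_neq0 ?gt_eqF// mesh_gt0. Qed.

Lemma half_weight_C1 j : C1_derivative (fun t => half_weight N s t j)
  (fun t => (0 * ph t (x j) + s * phi_t t (x j)) * half_weight N s t j).
Proof. by have := C1_phi (x j) => ?; rewrite /half_weight; C1_solve. Qed.

Lemma conj_fun_time_derivative j : (j <= N.+1)%N -> td (v j) (u j).
Proof.
move=> jN; have [h1 _] := w_wt jN.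
have h2 := C1_time_derivative T_gt0 (half_weight_C1 j).
apply: eq_time_derivative (time_derivativeM T_gt0 h2 h1) => t //.
by rewrite /u /conj_fun_t; ring.
Qed.

Lemma conj_fun_t_time_derivative j : (j <= N.+1)%N -> td (u j) (z j).
Proof.
move=> jN; have [h1 h1'] := w_wt jN.
have h2 := C1_time_derivative T_gt0 (half_weight_C1 j).
have h3 := C1_time_derivative T_gt0 (C1_phi_t (x j)).
have h4 := time_derivativeM T_gt0 (time_derivativeZ T_gt0 s h3) h1.
apply: eq_time_derivative (time_derivativeM T_gt0 h2 (time_derivativeD h1' h4)) => t //.
by rewrite /z /conj_fun_tt; ring.
Qed.

Lemma diff_plus_time_derivative (f g : nat -> R -> R) j : td (f j.+1) (g j.+1) -> td (f j) (g j) ->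
  td (fun t => diff_plus N (fun i => f i t) j) (fun t => diff_plus N (fun i => g i t) j).
Proof.
move=> h1 h2; have := time_derivativeZ T_gt0 h^-1 (time_derivativeB T_gt0 h1 h2).
by apply: eq_time_derivative => t; rewrite mulrC.
Qed.

Lemma node_flux_time_derivative j : (0 < j <= N)%N ->
  td (fun t => node_flux N s t (fun i => v i t) (fun i => u i t) j)
     (fun t => node_flux_t N s t (fun i => v i t) (fun i => u i t) (fun i => z i t) j).
Proof.
case: j => // j /andP[_ jN].
have hv i : (i <= N.+1)%N -> td (v i) (u i) by exact: conj_fun_time_derivative.
have hu : td (u j.+1) (z j.+1) by apply: conj_fun_t_time_derivative; rewrite leqW.
have d1 : td (fun t => diff_plus N (fun i => v i t) j.+1) (fun t => diff_plus N (fun i => u i t) j.+1).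
  by apply: diff_plus_time_derivative; apply: hv; rewrite // leqW.
have d2 : td (fun t => diff_plus N (fun i => v i t) j) (fun t => diff_plus N (fun i => u i t) j).
  by apply: diff_plus_time_derivative; apply: hv; rewrite leqW// ltnW.
have hv1 : td (v j.+1) (u j.+1) by apply: hv; rewrite leqW.
have g1 := C1_time_derivative T_gt0 (C1_gcoef (x j.+1) e_neq0).
have g2 := C1_time_derivative T_gt0 (C1_phi_t (x j.+1)).
have g3 := C1_time_derivative T_gt0 (C1_mphi_t (x j.+1) e_neq0).
have M := @time_derivativeM R T T_gt0.
have k1 := M _ _ _ _ (M _ _ _ _ g1 hu) (time_derivativeD d1 d2).
have k2 := M _ _ _ _ g2 (M _ _ _ _ hu hu).
have k3 := M _ _ _ _ g3 (M _ _ _ _ hv1 hv1).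
have k4 := time_derivativeB T_gt0 (time_derivativeZ T_gt0 s (time_derivativeB T_gt0 k1 k2))
  (time_derivativeZ T_gt0 (s ^+ 3) k3).
apply: eq_time_derivative k4 => t.
  by rewrite /node_flux /=; ring.
by rewrite /node_flux_t /=; ring.
Qed.

Lemma edge_flux_time_derivative j : (j <= N)%N ->
  td (fun t => edge_flux N s t (fun i => v i t) j)
     (fun t => edge_flux_t N s t (fun i => v i t) (fun i => u i t) j).
Proof.
move=> jN.
have d1 : td (fun t => diff_plus N (fun i => v i t) j) (fun t => diff_plus N (fun i => u i t) j).
  by apply: diff_plus_time_derivative; apply: conj_fun_time_derivative; rewrite // leqW.
have f1 := C1_time_derivative T_gt0 (C1_D (C1_fcoef e (x j)) (C1_fcoef e (x j.+1))).
have M := @time_derivativeM R T T_gt0.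
have k := time_derivativeZ T_gt0 (- (s / 2)) (M _ _ _ _ f1 (M _ _ _ _ d1 d1)).
by apply: eq_time_derivative k => t; rewrite /edge_flux /edge_flux_t; ring.
Qed.

Definition total_flux t : R :=
  h * (\sum_(1 <= j < N.+1) node_flux N s t (fun i => v i t) (fun i => u i t) j
    + \sum_(0 <= j < N.+1) edge_flux N s t (fun i => v i t) j).

Lemma total_flux_time_derivative :
  td total_flux (fun t => total_flux_t N s t
     (fun i => w i t) (fun i => wt i t) (fun i => wtt i t)).
Proof.
apply: time_derivativeZ => //; apply: time_derivativeD.
  apply: time_derivative_sum => // j; rewrite mem_index_iota => jN.
  exact: node_flux_time_derivative.
apply: time_derivative_sum => // j; rewrite mem_index_iota => /andP[_ jN].
exact: edge_flux_time_derivative.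
Qed.

Lemma total_flux_eq0 t : (forall j, (j <= N.+1)%N -> w j t = 0 /\ wt j t = 0) ->
  total_flux t = 0.
Proof.
move=> H.
have v0 j : (j <= N.+1)%N -> v j t = 0.
  by move=> /H[E _]; rewrite /v /conj_fun E mulr0.
have u0 j : (j <= N.+1)%N -> u j t = 0.
  by move=> /H[E F]; rewrite /u /conj_fun_t E F mulr0 addr0 mulr0.
rewrite /total_flux big1_seq ?big1_seq ?addr0 ?mulr0// => j;
  rewrite mem_index_iota => /andP[_ /andP[j0 jN]].
  by rewrite /edge_flux /diff_plus !v0//; [ring|exact: leqW].
by rewrite /node_flux v0 ?u0; [ring|exact: leqW..].
Qed.

End FluxDerivative.

End CarlemanEstimate.

(** * Integrals over the time interval *)

Section TimeIntegral.
Variables (R : realType) (T : R).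
Hypothesis T_gt0 : 0 < T.
Local Notation mu := (@lebesgue_measure R).
Local Notation I := (`[- T, T]%classic : set (measurableTypeR R)).
Implicit Types f g : R -> R.

Lemma int_timeZ (c : R) f : 0 <= c -> measurable_fun I f -> (forall t, I t -> 0 <= f t) ->
  (c%:E * int_time T f = int_time T (fun t => c * f t)%R)%E.
Proof.
move=> c0 mf f0; rewrite /int_time -ge0_integralZl_EFin//; last exact/measurable_EFinP.
Qed.

Lemma int_timeD f g : measurable_fun I f -> measurable_fun I g ->
  (forall t, I t -> 0 <= f t) -> (forall t, I t -> 0 <= g t) ->
  (int_time T f + int_time T g = int_time T (fun t => f t + g t)%R)%E.
Proof.
move=> mf mg f0 g0; rewrite /int_time -ge0_integralD//; exact/measurable_EFinP.
Qed.

(** If the right side is infinite there is nothing to prove. Otherwise [g] is integrable, and [Y']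
    integrates to 0 because [Y] agrees at the two ends. *)
Lemma int_time_le_flux f g Y Y' (c : R) :
  measurable_fun I f -> measurable_fun I g ->
  (forall t, I t -> 0 <= f t) -> (forall t, I t -> 0 <= g t) ->
  time_derivative T Y Y' -> Y (- T) = Y T ->
  (forall t, I t -> f t <= g t - c * Y' t) ->
  (int_time T f <= int_time T g)%E.
Proof.
move=> mf mg f0 g0 [iY YE] YT fg.
have [->|gfin] := eqVneq (int_time T g) +oo%E; first by rewrite leey.
have ig : mu.-integrable I (EFin \o g).
  apply/integrableP; split; first exact/measurable_EFinP.
  rewrite ltey; apply: contra_neq gfin => <-; apply: eq_integral => t tI /=.
  by rewrite ger0_norm// g0//; rewrite inE in tI.
have iY' : Rintegral mu I Y' = 0.
  have := YE T; rewrite in_itv/= lexx andbT => /(_ _) E.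
  have {}E : Y T = Y (- T) + Rintegral mu I Y' by apply: E; move: T_gt0; lra.
  by move: E; rewrite YT => /eqP; rewrite -[X in X == _]addr0 (inj_eq (addrI _)) => /eqP <-.
have icY : mu.-integrable I (EFin \o (fun t => c * Y' t)) by exact: EFin_integrableZ.
have igc : mu.-integrable I (EFin \o (fun t => g t - c * Y' t)) by exact: EFin_integrableB.
apply: (@le_trans _ _ (\int[mu]_(t in I) (g t - c * Y' t)%:E)%E).
  apply: ge0_le_integral => //.
    exact/measurable_EFinP.
  exact: (measurable_int mu).
have fE k : mu.-integrable I (EFin \o k) ->
    (\int[mu]_(t in I) (k t)%:E = (Rintegral mu I k)%:E)%E.
  by move=> ik; rewrite /Rintegral fineK// integrable_fin_num.
rewrite fE// RintegralB// RintegralZl// iY' mulr0 subr0 /int_time fE//.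
Qed.

(** Leaves the weak derivative unnamed; it serves to obtain measurability in time of the weighted
    squares. *)
Definition abs_continuous f := exists g, time_derivative T f g.

Lemma abs_continuousD f g : abs_continuous f -> abs_continuous g ->
  abs_continuous (fun t => f t + g t).
Proof. by move=> [f' ff] [g' gg]; exists (fun t => f' t + g' t); exact: time_derivativeD. Qed.

Lemma abs_continuousM f g : abs_continuous f -> abs_continuous g ->
  abs_continuous (fun t => f t * g t).
Proof.
move=> [f' ff] [g' gg]; exists (fun t => f' t * g t + f t * g' t).
exact: time_derivativeM.
Qed.

Lemma abs_continuousZ c f : abs_continuous f -> abs_continuous (fun t => c * f t).
Proof. by move=> [f' ff]; exists (fun t => c * f' t); exact: time_derivativeZ. Qed.

Lemma abs_continuous_measurable f : abs_continuous f -> measurable_fun I f.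
Proof. by move=> [g /(time_derivative_continuous T_gt0)]; exact: within_continuous_measurable. Qed.

Lemma measurable_fun_sum_seq (J : eqType) (r : seq J) (f : J -> R -> R) :
  (forall j, j \in r -> measurable_fun I (f j)) ->
  measurable_fun I (fun t => \sum_(j <- r) f j t).
Proof.
elim: r => [_|j r IH mf].
  have -> : (fun t => \sum_(j <- [::]) f j t) = (fun=> 0).
    by apply/funext => t; rewrite big_nil.
  exact: measurable_cst.
have -> : (fun t => \sum_(i <- j :: r) f i t) =
    (fun t => f j t + \sum_(i <- r) f i t).
  by apply/funext => t; rewrite big_cons.
apply: measurable_funD; first by apply: mf; rewrite mem_head.
by apply: IH => i ir; apply: mf; rewrite in_cons ir orbT.
Qed.

Lemma measurable_int_oo N (f : nat -> R -> R) :
  (forall j, (0 < j <= N)%N -> measurable_fun I (f j)) ->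
  measurable_fun I (fun t => int_oo N (fun j => f j t)).
Proof.
move=> mf; apply: measurable_funM; first exact: measurable_cst.
by apply: measurable_fun_sum_seq => j; rewrite mem_index_iota => ?; exact: mf.
Qed.

Lemma measurable_int_co N (f : nat -> R -> R) :
  (forall j, (j <= N)%N -> measurable_fun I (f j)) ->
  measurable_fun I (fun t => int_co N (fun j => f j t)).
Proof.
move=> mf; apply: measurable_funM; first exact: measurable_cst.
by apply: measurable_fun_sum_seq => j; rewrite mem_index_iota => /andP[_ ?]; exact: mf.
Qed.

End TimeIntegral.

Lemma int_oo_ge0 (R : realType) N (f : nat -> R) : (forall j, 0 <= f j) -> 0 <= int_oo N f.
Proof. by move=> f0; rewrite mulr_ge0 ?sumr_ge0// ltW// mesh_gt0. Qed.

Lemma int_co_ge0 (R : realType) N (f : nat -> R) : (forall j, 0 <= f j) -> 0 <= int_co N f.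
Proof. by move=> f0; rewrite mulr_ge0 ?sumr_ge0// ltW// mesh_gt0. Qed.

Lemma weight_sqr (R : realType) (x0 beta C0 lam s t y a : R) :
  expR (2 * s * phi x0 beta C0 lam t y) * `|a| ^+ 2 =
  (expR (s * phi x0 beta C0 lam t y) * a) ^+ 2.
Proof.
by rewrite exprMn real_normK ?num_real// [in RHS]expr2 -expRD; congr (expR _ * _); ring.
Qed.

Theorem corollary2p4 (R : realType) (T beta m x0 C0 : R)
    (T_gt0 : 0 < T) (beta_gt0 : 0 < beta) (beta_lt1 : beta < 1) (m_gt0 : 0 < m)
    (x0_lt0 : x0 < 0) (C0_gt0 : 0 < C0)
    (psi_ge1 : forall t x : R, t \in `[- T, T] -> x \in `[0, 1] ->
       1 <= psi x0 beta C0 t x) :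
  exists s0 lambda eps h0 M : R,
    [/\ 0 < s0, 0 < lambda, 0 < eps, 0 < h0 & 0 < M] /\
    forall N : nat, mesh R N < h0 ->
    forall q : nat -> R, discr_Linfty_le N m q ->
    forall s : R, s0 < s -> s < eps / mesh R N ->
    (* wt and wtt are the first and second time derivatives of w *)
    forall w wt wtt : nat -> R -> R,
      (forall j, (j <= N.+1)%N ->
         time_derivative T (w j) (wt j) /\ time_derivative T (wt j) (wtt j)) ->
      L2_time_L2h N T (wave_op N q w wtt) ->
      (forall t, t \in `]- T, T[ -> w 0%N t = 0 /\ w N.+1 t = 0) ->
      (forall j, (j <= N.+1)%N ->
         [/\ w j (- T) = 0, w j T = 0, wt j (- T) = 0 & wt j T = 0]) ->
      let W t x := expR (2 * s * phi x0 beta C0 lambda t x) in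
      (s%:E * int_time T (fun t =>
           int_oo N (fun j => W t (grid R N j) * `|wt j t| ^+ 2))%R
       + s%:E * int_time T (fun t =>
           int_co N (fun j => W t (grid R N j)
                              * `|diff_plus N (fun i => w i t) j| ^+ 2))%R
       + (s ^+ 3)%:E * int_time T (fun t =>
           int_oo N (fun j => W t (grid R N j) * `|w j t| ^+ 2))%R
       <= M%:E * int_time T (fun t =>
           int_oo N (fun j => W t (grid R N j) * `|wave_op N q w wtt j t| ^+ 2))%R
       + (M * s)%:E * int_time T (fun t =>
           W t 1 * `|diff_minus N (fun i => w i t) N.+1| ^+ 2)%R
       + (M * s)%:E * int_time T (fun t =>
           int_co N (fun j => W t (grid R N j)
             * `|mesh R N * diff_plus N (fun i => wt i t) j| ^+ 2))%R)%E.
Proof.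
(* Equality in the threshold lambda (1 - beta) x0^2 >= 1. *)
pose lam := ((1 - beta) * x0 ^+ 2)^-1.
have bx_gt0 : 0 < (1 - beta) * x0 ^+ 2.
  by rewrite mulr_gt0 ?subr_gt0// exprn_even_gt0//= lt_eqF.
have lam_gt0 : 0 < lam by rewrite invr_gt0.
have lam_ge : 1 <= lam * (1 - beta) * x0 ^+ 2 by rewrite -mulrA mulVf// gt_eqF.
have phi_ge1 w : cell_ok T w -> 1 <= phi x0 beta C0 lam (ct w) (cx w).
  move=> [tT xI _ _ _]; rewrite -expR0 ler_expR mulr_ge0 ?(ltW lam_gt0)//.
  apply: le_trans ler01 (psi_ge1 _ _ _ _) => //.
  by rewrite in_itv/= -ler_norml.
have [s0 [eps [M [M' [[s00 eps0 M0 M'0] H]]]]] :=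
  static_estimate lam_gt0 beta_gt0 beta_lt1 x0_lt0 lam_ge phi_ge1 (ltW m_gt0).
(* Smallness of the mesh enters through s h < eps, so 1 serves as [h0]. *)
exists s0, lam, eps, 1, M; split => // N _ q qm s s0s seps w wt wtt w_wt wL2 wbd wend.
pose W t x := expR (2 * s * phi x0 beta C0 lam t x).
have sp : 0 < s by exact: lt_trans s0s.
have hp := @mesh_gt0 R N.
have she : s * mesh R N < eps by rewrite -ltr_pdivlMr.
have NTT : - T < T by move: T_gt0; lra.
(* The Dirichlet condition is given on the open interval; at the two end times it follows from the
   vanishing of w. *)
have w0 t : t \in `[- T, T] -> w 0%N t = 0 /\ w N.+1 t = 0.
  rewrite in_itv/= !le_eqVlt => /andP[/orP[/eqP<- _|t1 /orP[/eqP->|t2]]].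
  - by have [-> _ _ _] := wend 0%N isT; have [-> _ _ _] := wend N.+1 (leqnn _).
  - by have [_ -> _ _] := wend 0%N isT; have [_ -> _ _] := wend N.+1 (leqnn _).
  - by apply: wbd; rewrite in_itv/= t1.
have wt0 j : (j <= N.+1)%N -> (forall t, t \in `[- T, T] -> w j t = 0) ->
    forall t, t \in `[- T, T] -> wt j t = 0.
  move=> jN wj0 t; have [h1 h2] := w_wt j jN; have [_ _ e1 e2] := wend j jN.
  rewrite in_itv/= !le_eqVlt => /andP[/orP[/eqP<- _|t1 /orP[/eqP->|t2]]] //.
  have c2 := time_derivative_continuous T_gt0 h2.
  apply: (time_derivative_eq0 h1 c2); last by rewrite in_itv/= t1.
  by move=> r; rewrite inE; exact: wj0.
have wt00 t (tI : t \in `[- T, T]) : wt 0%N t = 0 := wt0 0%N isT (fun t tI => (w0 t tI).1) t tI.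
have wtN0 t (tI : t \in `[- T, T]) : wt N.+1 t = 0 :=
  wt0 N.+1 (leqnn _) (fun t tI => (w0 t tI).2) t tI.
pose E j t := half_weight x0 beta C0 lam N s t j.
have acE j : abs_continuous T (E j).
  by have h := C1_time_derivative T_gt0 (half_weight_C1 x0 beta C0 lam N s j); eexists; exact: h.
have acw j : (j <= N.+1)%N -> abs_continuous T (w j) by move=> /w_wt[h _]; eexists; exact: h.
have acwt j : (j <= N.+1)%N -> abs_continuous T (wt j) by move=> /w_wt[_ h]; eexists; exact: h.
have acd (f : nat -> R -> R) j : abs_continuous T (f j.+1) -> abs_continuous T (f j) ->
    abs_continuous T (fun t => diff_plus N (fun i => f i t) j).
  move=> a1 a2; have a3 := abs_continuousD a1 (abs_continuousZ T_gt0 (-1) a2).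
  have := abs_continuousZ T_gt0 (mesh R N)^-1 a3; congr abs_continuous.
  by apply/funext => t; rewrite /diff_plus; ring.
have sqm f j : abs_continuous T f -> measurable_fun (`[- T, T]%classic : set (measurableTypeR R))
     (fun t => (E j t * f t) ^+ 2).
  move=> af; apply: measurable_funX; apply: abs_continuous_measurable => //.
  exact: abs_continuousM.
pose f1 t := int_oo N (fun j => (E j t * wt j t) ^+ 2).
pose f2 t := int_co N (fun j => (E j t * diff_plus N (fun i => w i t) j) ^+ 2).
pose f3 t := int_oo N (fun j => (E j t * w j t) ^+ 2).
pose g1 t := int_oo N (fun j => (E j t * wave_op N q w wtt j t) ^+ 2).
pose g2 t := (E N.+1 t * diff_minus N (fun i => w i t) N.+1) ^+ 2.
pose g3 t := int_co N (fun j => (E j t * (mesh R N * diff_plus N (fun i => wt i t) j)) ^+ 2).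
have W1 t a : W t 1 * `|a| ^+ 2 = (E N.+1 t * a) ^+ 2.
  by rewrite /E /half_weight grid_last; exact: weight_sqr.
have e1 : (fun t => int_oo N (fun j => W t (grid R N j) * `|wt j t| ^+ 2)) = f1.
  by apply/funext => t; congr int_oo; apply/funext => j; exact: weight_sqr.
have e2 : (fun t => int_co N (fun j => W t (grid R N j) *
    `|diff_plus N (fun i => w i t) j| ^+ 2)) = f2.
  by apply/funext => t; congr int_co; apply/funext => j; exact: weight_sqr.
have e3 : (fun t => int_oo N (fun j => W t (grid R N j) * `|w j t| ^+ 2)) = f3.
  by apply/funext => t; congr int_oo; apply/funext => j; exact: weight_sqr.
have e4 : (fun t => int_oo N (fun j => W t (grid R N j) *
    `|wave_op N q w wtt j t| ^+ 2)) = g1.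
  by apply/funext => t; congr int_oo; apply/funext => j; exact: weight_sqr.
have e5 : (fun t => W t 1 * `|diff_minus N (fun i => w i t) N.+1| ^+ 2) = g2.
  by apply/funext => t; exact: W1.
have e6 : (fun t => int_co N (fun j => W t (grid R N j) *
    `|mesh R N * diff_plus N (fun i => wt i t) j| ^+ 2)) = g3.
  by apply/funext => t; congr int_co; apply/funext => j; exact: weight_sqr.
suff main : (s%:E * int_time T f1 + s%:E * int_time T f2 + (s ^+ 3)%:E * int_time T f3 <=
    M%:E * int_time T g1 + (M * s)%:E * int_time T g2 + (M * s)%:E * int_time T g3)%E.
  by rewrite -e1 -e2 -e3 -e4 -e5 -e6 in main; exact: main.
have f1_ge0 t : 0 <= f1 t by apply: int_oo_ge0 => j; exact: sqr_ge0.
have f2_ge0 t : 0 <= f2 t by apply: int_co_ge0 => j; exact: sqr_ge0.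
have f3_ge0 t : 0 <= f3 t by apply: int_oo_ge0 => j; exact: sqr_ge0.
have g1_ge0 t : 0 <= g1 t by apply: int_oo_ge0 => j; exact: sqr_ge0.
have g2_ge0 t : 0 <= g2 t by exact: sqr_ge0.
have g3_ge0 t : 0 <= g3 t by apply: int_co_ge0 => j; exact: sqr_ge0.
pose I : set (measurableTypeR R) := `[- T, T]%classic.
have mf1 : measurable_fun I f1.
  by apply: measurable_int_oo => j /andP[_ jN]; apply: sqm; apply: acwt; exact: leqW.
have mf2 : measurable_fun I f2.
  apply: measurable_int_co => j jN; apply: sqm; apply: acd; apply: acw => //; exact: leqW.
have mf3 : measurable_fun I f3.
  by apply: measurable_int_oo => j /andP[_ jN]; apply: sqm; apply: acw; exact: leqW.
have mg1 : measurable_fun I g1.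
  apply: measurable_int_oo => j jN; apply: measurable_funX; apply: measurable_funM.
    exact: abs_continuous_measurable.
  by have [mw _] := wL2; exact: mw.
have mg2 : measurable_fun I g2 by apply: sqm; apply: (acd w N); apply: acw.
have mg3 : measurable_fun I g3.
  apply: measurable_int_co => j jN; apply: sqm; apply: abs_continuousZ => //.
  by apply: acd; apply: acwt => //; exact: leqW.
have s3 : 0 <= s ^+ 3 by rewrite exprn_ge0// ltW.
have Ms : 0 <= M * s by rewrite mulr_ge0 ?ltW.
have mZ (c : R) (f : R -> R) : measurable_fun I f -> measurable_fun I (fun t => c * f t).
  by move=> mf; apply: measurable_funM => //; exact: measurable_cst.
(* By nonnegativity and measurability each side becomes one extended-real integral, so that the
   estimate at fixed time can be integrated. *)
rewrite !int_timeZ ?(ltW sp) ?(ltW M0)//.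
have sZ (c : R) (f : R -> R) : 0 <= c -> (forall t, 0 <= f t) -> forall t, 0 <= c * f t.
  by move=> c0 f0 t; rewrite mulr_ge0.
have mD (f g : R -> R) : measurable_fun I f -> measurable_fun I g ->
   measurable_fun I (fun t => f t + g t) by move=> *; exact: measurable_funD.
rewrite !int_timeD//; try by [exact: mZ | apply: mD; exact: mZ
  | move=> t _; rewrite ?addr_ge0// mulr_ge0// ltW].
have tf := total_flux_time_derivative x0 beta C0 lam T_gt0 sp w_wt.
apply: (int_time_le_flux T_gt0 _ _ _ _ tf (c := M')).
- by apply: (mD (fun t => s * f1 t + s * f2 t)); [apply: mD|]; exact: mZ.
- by apply: (mD (fun t => M * g1 t + M * s * g2 t)); [apply: mD|]; exact: mZ.
- by move=> t _; rewrite !addr_ge0// mulr_ge0// ltW.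
- by move=> t _; rewrite !addr_ge0// mulr_ge0// ltW.
- by rewrite !total_flux_eq0// => j /wend[].
- move=> t tI; have tI' : t \in `[- T, T] by [].
  have tT : `|t| <= T by rewrite ler_norml; move: tI'; rewrite in_itv.
  have [a1 a2] := w0 t tI'.
  exact: (H N s t q (fun i => w i t) (fun i => wt i t) (fun i => wtt i t) tT s0s she qm
    a1 a2 (wt00 t tI') (wtN0 t tI')).
Qed.
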